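(* Let $V$ be a vector space over a field $\mathbb{F}$ with a linearly ordered basis $\mathbb{B}$, let $p,t\in\mathbb{F}$ be nonzero, and assume $[n]_p\neq0$ for all $n\ge1$ (so that all $p$-divided powers are defined). Then the $R$-matrix $$\rho=(\phi_t\otimes\lambda_R)(\hat\tau\otimes\mathrm{id})(\mathrm{id}\otimes\Delta)\colon\Lambda_p(V)\otimes\Lambda_p(V)\to\Lambda_p(V)\otimes\Lambda_p(V)$$ acts, for all finite subsets $E,F\subseteq\mathbb{B}$, by $$\rho f_{E,F}=\sum_{k=0}^{\min(|E|,|F|)}t^k\gamma_k\,W_{|F|-k}\big(tp^{|E|},tL;p\big)\,R^{\langle|E|-k\rangle_p}f_{E,F},\qquad W_n(x,y;p):=\sum_{i=0}^n(x;p)_{n-i}\,y^{\langle i\rangle_p}.$$ Equivalently, for all $m,n\ge0$ and $0\le i\le n$, $$(\pi_i\otimes\pi_{m+n-i})\,\rho\,(\pi_m\otimes\pi_n)=t^i(tp^m;p)_{n-i}\sum_{k=0}^{\min(i,m)}\gamma_k\,(\nabla\otimes\mathrm{id})(\mathrm{id}\otimes\Delta_{i-k)})(\mathrm{id}\otimes\nabla)(\Delta_{(m-k}\otimes\mathrm{id})(\pi_m\otimes\pi_n).$$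
   Context: Braided Hopf algebra $\Lambda_p(V)$: let $\tau$ on $V\otimes V$ be given by $\tau(a\otimes a)=-a\otimes a$; $\tau(a\otimes b)=-(1-p)a\otimes b-b\otimes a$ if $a>b$; $\tau(a\otimes b)=-p\,b\otimes a$ if $a<b$ ($a,b\in\mathbb{B}$). As an algebra $\Lambda_p(V)$ is the exterior algebra $\bigwedge V$, with product $\nabla$ and unit $1$. Its braiding $\hat\tau$ is the unique linear map on $\Lambda_p(V)^{\otimes2}$ with $\hat\tau|_{V\otimes V}=\tau$, $\hat\tau(1\otimes x)=x\otimes1$, $\hat\tau(x\otimes1)=1\otimes x$, $\hat\tau(\nabla\otimes\nabla)=(\nabla\otimes\nabla)(\mathrm{id}\otimes\hat\tau\otimes\mathrm{id})(\hat\tau\otimes\hat\tau)(\mathrm{id}\otimes\hat\tau\otimes\mathrm{id})$. Its coproduct $\Delta$ is the unique linear map with $\Delta1=1\otimes1$, $\Delta v=v\otimes1+1\otimes v$ ($v\in V$), $\Delta\nabla=(\nabla\otimes\nabla)(\mathrm{id}\otimes\hat\tau\otimes\mathrm{id})(\Delta\otimes\Delta)$. The counit $\epsilon$ kills positive degrees, and the antipode $S$ is the convolution inverse of $\mathrm{id}$. Notation: for a finite $E=\{e_1<\dots<e_n\}\subseteq\mathbb{B}$, $f_E=e_1\cdots e_n$ ($f_\emptyset=1$); these form a basis of $\Lambda_p(V)$; $f_{E,F}=f_E\otimes f_F$. $\pi_k\colon\Lambda_p(V)\to\Lambda_p^k(V)$ is the projection to the degree $k$ part (regarded as an endomorphism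 of $\Lambda_p(V)$). $\Delta_{k)}=(\pi_k\otimes\mathrm{id})\Delta$, $\Delta_{(k}=(\mathrm{id}\otimes\pi_k)\Delta$. $L=(\nabla\otimes\mathrm{id})(\mathrm{id}\otimes\Delta_{1)})$ and $R=(\mathrm{id}\otimes\nabla)(\Delta_{(1}\otimes\mathrm{id})$ are endomorphisms of $\Lambda_p(V)^{\otimes2}$. $\phi_t$ is the automorphism $\phi_tf_E=t^{|E|}f_E$. The map $\lambda_R\colon\Lambda_p(V)\otimes\Lambda_p(V)\to\Lambda_p(V)$ is $\lambda_R=\nabla^{(2)}((S\phi_t)\otimes\mathrm{id}\otimes\mathrm{id})(\hat\tau\otimes\mathrm{id})(\mathrm{id}\otimes\Delta)$, where $\nabla^{(2)}=\nabla(\nabla\otimes\mathrm{id})$. $\gamma_k=(-1)^kp^{k(k-1)/2}$; $(x;p)_n=\prod_{i=0}^{n-1}(1-xp^i)$; $[n]_p=\sum_{i=0}^{n-1}p^i$; $[n]_p^!=\prod_{i=1}^n[i]_p$; $x^{\langle n\rangle_p}=x^n/[n]_p^!$. *)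

(* Defs.v *)
From HB Require Import structures.
From mathcomp Require Import all_boot all_order all_algebra.
From mathcomp Require Export finmap.
From mathcomp.multinomials Require Export monalg.

Set Implicit Arguments.
Unset Strict Implicit.
Unset Printing Implicit Defensive.

Import Order.TTheory GRing.Theory.

Local Open Scope fset_scope.
Local Open Scope ring_scope.

(* {malg F[K]} is the F-vector space with basis <<k>>, k : K, and the tensor
   product of {malg F[K]} and {malg F[L]} is {malg F[K * L]}.                 *)

Section LinearExtension.
Context {F : fieldType} {K : choiceType} {M : lmodType F}.

Definition lext (h : K -> M) (x : {malg F[K]}) : M :=
  \sum_(k <- msupp x) x@_k *: h k.

Lemma lextEw (h : K -> M) (x : {malg F[K]}) (D : {fset K}) :
  msupp x `<=` D -> lext h x = \sum_(k <- D) x@_k *: h k.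
Proof.
move=> sxD; rewrite /lext (big_fset_incl _ sxD) // => k _ kNx.
by rewrite mcoeff_outdom // scale0r.
Qed.

Fact lext_is_linear (h : K -> M) : linear (lext h).
Proof.
move=> a x y; pose D := msupp x `|` msupp y `|` msupp (a *: x + y).
have sD z : z \in [:: x; y; a *: x + y] -> msupp z `<=` D.
  rewrite !inE => /or3P[]/eqP->; apply/fsubsetP => k kz;
  by rewrite /D !in_fsetU kz ?orbT.
rewrite !(@lextEw _ _ D) ?sD ?inE ?eqxx ?orbT //.
rewrite scaler_sumr -big_split /=; apply: eq_bigr => k _.
by rewrite mcoeffD mcoeffZ scalerDl scalerA.
Qed.

HB.instance Definition _ (h : K -> M) :=
  GRing.isLinear.Build F {malg F[K]} M *:%R (lext h) (lext_is_linear h).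

Lemma lextU (h : K -> M) (k : K) : lext h << k >> = h k.
Proof. by rewrite /lext msuppU oner_eq0 big_seq_fset1 mcoeffUU scale1r. Qed.

End LinearExtension.

Section Tensor.
Context {F : fieldType}.

Definition tens {K L : choiceType} (x : {malg F[K]}) (y : {malg F[L]}) :
    {malg F[(K * L)%type]} :=
  lext (fun k => lext (fun l => << (k, l) >>) y) x.

(* Reads off f and g on basis vectors only, so f and g are meant to be linear. *)
Definition tmap {K K' L L' : choiceType}
    (f : {malg F[K]} -> {malg F[K']}) (g : {malg F[L]} -> {malg F[L']}) :
    {malg F[(K * L)%type]} -> {malg F[(K' * L')%type]} :=
  lext (fun kl => tens (f << kl.1 >>) (g << kl.2 >>)).

Definition assocl {K L M : choiceType} :
    {malg F[(K * (L * M))%type]} -> {malg F[(K * L * M)%type]} :=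
  lext (fun k => << (k.1, k.2.1, k.2.2) >>).

Definition assocr {K L M : choiceType} :
    {malg F[(K * L * M)%type]} -> {malg F[(K * (L * M))%type]} :=
  lext (fun k => << (k.1.1, (k.1.2, k.2)) >>).

(* id (x) h (x) id on a fourfold tensor power bracketed as (12)(34). *)
Definition midmap {K : choiceType}
    (h : {malg F[(K * K)%type]} -> {malg F[(K * K)%type]}) :
    {malg F[((K * K) * (K * K))%type]} -> {malg F[((K * K) * (K * K))%type]} :=
  assocr \o tmap (assocl \o tmap idfun h \o assocr) idfun \o assocl.

End Tensor.

Notation "f ⊗ g" := (tmap f g) (at level 40, left associativity).

Section PNumbers.
Context {F : fieldType}.

Definition gammap (p : F) (k : nat) : F := (-1) ^+ k * p ^+ (k * k.-1)./2.

Definition pochp (x p : F) (n : nat) : F := \prod_(i < n) (1 - x * p ^+ i).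

Definition numberp (p : F) (n : nat) : F := \sum_(i < n) p ^+ i.

Definition factp (p : F) (n : nat) : F := \prod_(1 <= i < n.+1) numberp p i.

Definition divpow {M : lmodType F} (p : F) (n : nat) (Y : M -> M) (z : M) : M :=
  (factp p n)^-1 *: iter n Y z.

Definition Wp {M : lmodType F} (n : nat) (x : F) (Y : M -> M) (p : F) (z : M) :
    M :=
  \sum_(i < n.+1) pochp x p (n - i) *: divpow p i Y z.

End PNumbers.

(* The vector space V with ordered basis B, and its exterior algebra, with
   basis f_E = << E >> for E a finite subset of B.                           *)
Notation freeV F B := {malg F[B]} (only parsing).
Notation Lam F B := {malg F[{fset B}]}.
Notation Lam2 F B := {malg F[({fset B} * {fset B})%type]}.

Section ExteriorAlgebra.
Context {disp : Order.disp_t} {B : orderType disp} {F : fieldType}.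

Fixpoint inversions (w : seq B) : nat :=
  if w is a :: w' then (count (fun b => b < a)%O w' + inversions w')%N else 0%N.

(* The exterior product of the basis vectors listed in w, in this order: zero if
   one is repeated, and otherwise the sign of the permutation sorting w times
   the product in increasing order, which is the basis element f_E = << E >>. *)
Definition wedge (w : seq B) : Lam F B :=
  if uniq w then (-1) ^+ inversions w *: << [fset b in w] >> else 0.

Definition nabla : Lam2 F B -> Lam F B :=
  lext (fun EG : {fset B} * {fset B} => wedge (sort <=%O EG.1 ++ sort <=%O EG.2)).

Definition nabla2 :
    {malg F[({fset B} * {fset B} * {fset B})%type]} -> Lam F B :=
  nabla \o (nabla ⊗ idfun).

Definition oneL : Lam F B := << fset0 >>.

Definition counit (x : Lam F B) : F := x@_fset0.

Definition incl : freeV F B -> Lam F B := lext (fun a => << [fset a] >>).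

Definition piL (k : nat) : Lam F B -> Lam F B :=
  lext (fun E : {fset B} => if #|` E| == k then << E >> else 0).

Definition phi (t : F) : Lam F B -> Lam F B :=
  lext (fun E : {fset B} => t ^+ #|` E| *: << E >>).

Definition tau (p : F) : {malg F[(B * B)%type]} -> {malg F[(B * B)%type]} :=
  lext (fun ab => let: (a, b) := ab in
    if a == b then - << (a, a) >>
    else if (b < a)%O then - (1 - p) *: << (a, b) >> - << (b, a) >>
    else - p *: << (b, a) >>).

(* The three records below are the conditions that characterize the braiding,
   the coproduct and the antipode among linear maps.                          *)
Record is_braiding (p : F) (T : {linear Lam2 F B -> Lam2 F B}) : Prop := {
  braiding_V : T \o (incl ⊗ incl) =1 (incl ⊗ incl) \o tau p;
  braiding_1l : forall x : Lam F B, T (tens oneL x) = tens x oneL;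
  braiding_1r : forall x : Lam F B, T (tens x oneL) = tens oneL x;
  braiding_nabla :
    T \o (nabla ⊗ nabla)
    =1 (nabla ⊗ nabla) \o midmap T \o (T ⊗ T) \o midmap T }.

Record is_coproduct (T : {linear Lam2 F B -> Lam2 F B})
    (Delta : {linear Lam F B -> Lam2 F B}) : Prop := {
  coproduct_1 : Delta oneL = tens oneL oneL;
  coproduct_V : forall v : freeV F B,
    Delta (incl v) = tens (incl v) oneL + tens oneL (incl v);
  coproduct_nabla :
    Delta \o nabla =1 (nabla ⊗ nabla) \o midmap T \o (Delta ⊗ Delta) }.

Record is_antipode (Delta : {linear Lam F B -> Lam2 F B})
    (S : {linear Lam F B -> Lam F B}) : Prop := {
  antipode_l : forall x, nabla ((S ⊗ idfun) (Delta x)) = counit x *: oneL;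
  antipode_r : forall x, nabla ((idfun ⊗ S) (Delta x)) = counit x *: oneL }.

Definition Delta_l (Delta : Lam F B -> Lam2 F B) (k : nat) :
    Lam F B -> Lam2 F B :=
  (piL k ⊗ idfun) \o Delta.

Definition Delta_r (Delta : Lam F B -> Lam2 F B) (k : nat) :
    Lam F B -> Lam2 F B :=
  (idfun ⊗ piL k) \o Delta.

Definition Lop (Delta : Lam F B -> Lam2 F B) : Lam2 F B -> Lam2 F B :=
  (nabla ⊗ idfun) \o assocl \o (idfun ⊗ Delta_l Delta 1).

Definition Rop (Delta : Lam F B -> Lam2 F B) : Lam2 F B -> Lam2 F B :=
  (idfun ⊗ nabla) \o assocr \o (Delta_r Delta 1 ⊗ idfun).

Definition lambdaR (T : Lam2 F B -> Lam2 F B) (Delta : Lam F B -> Lam2 F B)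
    (S : Lam F B -> Lam F B) (t : F) : Lam2 F B -> Lam F B :=
  nabla2 \o (((S \o phi t) ⊗ idfun) ⊗ idfun) \o (T ⊗ idfun) \o assocl
    \o (idfun ⊗ Delta).

Definition Rmatrix (T : Lam2 F B -> Lam2 F B) (Delta : Lam F B -> Lam2 F B)
    (S : Lam F B -> Lam F B) (t : F) : Lam2 F B -> Lam2 F B :=
  (phi t ⊗ lambdaR T Delta S t) \o assocr \o (T ⊗ idfun) \o assocl
    \o (idfun ⊗ Delta).

End ExteriorAlgebra.

(* Main.v *)
From HB Require Import structures.
From mathcomp Require Import all_boot all_order all_algebra.
From mathcomp Require Import ring zify.
Require Import Defs.

(* Everything follows from the braiding, coproduct and antipode on the basis f_E.
   Induction on E, removing its minimum, gives
   Delta f_E = \sum (-p)^inv(A, C) f_A (x) f_C over the splittings E = A + C, where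
   inv counts the pairs c < a, while f_A f_C = (-1)^inv(A, C) f_E. So composing
   the product with a component of Delta multiplies f_E by a p-binomial
   coefficient; hence L^<i> = (nabla (x) id)(id (x) Delta_i), similarly for R, and
   the p-binomial theorem gives S f_E = gamma_|E| f_E. The hexagon relations give
   nabla T = p^(m n) nabla in degree (m, n), whence
   lambda_R (f (x) g) = (t p^m; p)_|g| f g by the p-binomial theorem again.
   Therefore the part of rho whose first factor has degree i is, up to the scalar
   t^i (t p^m; p)_(n - i), that of (id (x) nabla)(T (x) id)(f (x) Delta g), which is
   S(f') Delta(f'' g) since the antipode cancels f' against its own coproduct. *)

Set Implicit Arguments.
Unset Strict Implicit.
Unset Printing Implicit Defensive.

Import Order.TTheory GRing.Theory.

Local Open Scope fset_scope.
Local Open Scope ring_scope.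

(* Sealed: a failed unification would otherwise unfold << k >> to a finite map. *)
HB.lock Definition bas (F : fieldType) (K : choiceType) (k : K) : {malg F[K]} :=
  << k >>.
Arguments bas {F K} k.
Notation "''f_' k" := (bas k) (at level 8, k at level 2, format "''f_' k").

Lemma basE (F : fieldType) (K : choiceType) (k : K) : << k >> = 'f_k :> {malg F[K]}.
Proof. by rewrite bas.unlock. Qed.

Lemma lext_bas {F : fieldType} {K : choiceType} {M : lmodType F} (h : K -> M)
    (k : K) : lext h 'f_k = h k.
Proof. by rewrite -basE lextU. Qed.

Lemma lextZ {F : fieldType} {K : choiceType} {M : lmodType F} (h : K -> M) c x :
  lext h (c *: x) = c *: lext h x.
Proof. exact: linearZ_LR. Qed.

(** * Supports and tensor products *)

Section Support.
Context {F : fieldType}.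
Implicit Types K L : choiceType.

(** With degree predicates for [P], this expresses homogeneity. A linear identity whose scalars
    depend on degrees can then be checked on the basis vectors that actually occur. *)
Definition supported K (P : pred K) (x : {malg F[K]}) : Prop :=
  forall k, k \in msupp x -> P k.

Lemma malg_sumU K (x : {malg F[K]}) : x = \sum_(k <- msupp x) x@_k *: 'f_k.
Proof.
rewrite {1}[x]monalgE; apply: eq_bigr => k _; apply/malgP => l.
by rewrite mcoeffZ -basE !mcoeffU mulr_natr.
Qed.

Lemma eq_linear_supp K (M : lmodType F) (P : pred K) (x : {malg F[K]})
    (f g : {linear {malg F[K]} -> M}) :
  supported P x -> (forall k, P k -> f 'f_k = g 'f_k) -> f x = g x.
Proof.
move=> Px fg; rewrite [x]malg_sumU !linear_sum big_seq [RHS]big_seq.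
by apply: eq_bigr => k /Px /fg fgk; rewrite !linearZ /= fgk.
Qed.

Lemma eq_linear K (M : lmodType F) (f g : {linear {malg F[K]} -> M}) :
  (forall k, f 'f_k = g 'f_k) -> f =1 g.
Proof. by move=> fg x; apply: (@eq_linear_supp _ _ predT) => // k _. Qed.

Lemma supportedU K (P : pred K) k : P k -> supported P 'f_k.
Proof. by move=> Pk l; rewrite -basE msuppU oner_eq0 inE => /eqP->. Qed.

Lemma supported0 K (P : pred K) : supported P 0.
Proof. by move=> l; rewrite msupp0 in_fset0. Qed.

Lemma supportedD K (P : pred K) x y :
  supported P x -> supported P y -> supported P (x + y).
Proof.
by move=> Px Py k /(fsubsetP (msuppD_le _ _)); rewrite inE => /orP[/Px|/Py].
Qed.

Lemma supportedZ K (P : pred K) c x : supported P x -> supported P (c *: x).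
Proof. by move=> Px k /(fsubsetP (msuppZ_le _ _))/Px. Qed.

Lemma supportedN K (P : pred K) x : supported P x -> supported P (- x).
Proof. by rewrite -scaleN1r; apply: supportedZ. Qed.

Lemma supported_sum K (P : pred K) (I : Type) (r : seq I) (Q : pred I) f :
  (forall i, Q i -> supported P (f i)) -> supported P (\sum_(i <- r | Q i) f i).
Proof.
move=> Pf; apply: (big_ind (supported P)) => //; first exact: supported0.
exact: supportedD.
Qed.

Lemma supported_linear K L (P : pred K) (Q : pred L)
    (f : {linear {malg F[K]} -> {malg F[L]}}) x :
  supported P x -> (forall k, P k -> supported Q (f 'f_k)) ->
  supported Q (f x).
Proof.
move=> Px Qf; rewrite [x]malg_sumU linear_sum big_seq.
by apply: supported_sum => k /Px/Qf Qk; rewrite linearZ /=; apply: supportedZ.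
Qed.

End Support.

Section TensorTheory.
Context {F : fieldType}.
Implicit Types K L M : choiceType.

Lemma tensUU K L k l : tens 'f_k 'f_l = 'f_(k, l) :> {malg F[(K * L)%type]}.
Proof. by rewrite /tens !lext_bas basE. Qed.

Fact tens_is_linear_r K L (x : {malg F[K]}) : linear (@tens F K L x).
Proof.
move=> a y z; rewrite /tens /lext scaler_sumr -big_split /=.
apply: eq_bigr => k _; rewrite -/(lext _ y) -/(lext _ z) -/(lext _ (a *: y + z)).
by rewrite linearP scalerDr !scalerA mulrC.
Qed.

HB.instance Definition _ K L (x : {malg F[K]}) :=
  GRing.isLinear.Build F _ _ *:%R (@tens F K L x) (tens_is_linear_r x).

(** The swapped argument order makes linearity in the first factor available as an instance, next to
    that of [tens x] in the second. *)
Definition tensr K L (y : {malg F[L]}) (x : {malg F[K]}) := tens x y.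

Fact tensr_is_linear K L (y : {malg F[L]}) : linear (@tensr K L y).
Proof. by move=> a x z; rewrite /tensr /tens linearP. Qed.

HB.instance Definition _ K L (y : {malg F[L]}) :=
  GRing.isLinear.Build F _ _ *:%R (@tensr K L y) (tensr_is_linear y).

Lemma tensZl K L a (x : {malg F[K]}) (y : {malg F[L]}) :
  tens (a *: x) y = a *: tens x y.
Proof. exact: (linearZ_LR (tensr y)). Qed.

Lemma tensZr K L a (x : {malg F[K]}) (y : {malg F[L]}) :
  tens x (a *: y) = a *: tens x y.
Proof. exact: linearZ_LR. Qed.

HB.instance Definition _ K K' L L' (f : {malg F[K]} -> {malg F[K']})
    (g : {malg F[L]} -> {malg F[L']}) :=
  GRing.isLinear.Build F _ _ *:%R (f ⊗ g) (lext_is_linear _).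

HB.instance Definition _ K L M :=
  GRing.isLinear.Build F _ _ *:%R (@assocl F K L M) (lext_is_linear _).

HB.instance Definition _ K L M :=
  GRing.isLinear.Build F _ _ *:%R (@assocr F K L M) (lext_is_linear _).

Lemma tmapU K K' L L' (f : {malg F[K]} -> {malg F[K']})
    (g : {malg F[L]} -> {malg F[L']}) k l :
  (f ⊗ g) 'f_(k, l) = tens (f 'f_k) (g 'f_l).
Proof. by rewrite /tmap lext_bas /= !basE. Qed.

Lemma tmapZ K K' L L' (f : {malg F[K]} -> {malg F[K']})
    (g : {malg F[L]} -> {malg F[L']}) c x :
  (f ⊗ g) (c *: x) = c *: (f ⊗ g) x.
Proof. exact: linearZ_LR. Qed.

Lemma tmap_tens K K' L L' (f : {linear {malg F[K]} -> {malg F[K']}})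
    (g : {linear {malg F[L]} -> {malg F[L']}}) x y :
  (f ⊗ g) (tens x y) = tens (f x) (g y).
Proof.
rewrite -[tens x y]/(tensr y x) -[RHS]/((tensr (g y) \o f) x).
rewrite -[LHS]/((f ⊗ g \o tensr y) x); apply: eq_linear => k /=.
rewrite /tensr -[LHS]/((f ⊗ g \o tens _) y) -[RHS]/((tens _ \o g) y).
by apply: eq_linear => l /=; rewrite tensUU tmapU.
Qed.

Lemma assoclU K L M k l m :
  assocl 'f_(k, (l, m)) = 'f_(k, l, m) :> {malg F[(K * L * M)%type]}.
Proof. by rewrite /assocl lext_bas basE. Qed.

Lemma assocrU K L M k l m :
  assocr 'f_(k, l, m) = 'f_(k, (l, m)) :> {malg F[(K * (L * M))%type]}.
Proof. by rewrite /assocr lext_bas basE. Qed.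

Lemma eq_tmap K K' L L' (f f' : {malg F[K]} -> {malg F[K']})
    (g g' : {malg F[L]} -> {malg F[L']}) :
  f =1 f' -> g =1 g' -> f ⊗ g =1 f' ⊗ g'.
Proof.
by move=> ff gg x; apply: eq_bigr => -[k l] _; rewrite ff gg.
Qed.

HB.instance Definition _ K h :=
  GRing.isLinear.Build F _ _ *:%R (@midmap F K h)
    (linearP (assocr \o (assocl \o (idfun ⊗ h) \o assocr) ⊗ idfun \o assocl)).

Lemma midmapU K h (a b c d : K) :
  midmap h 'f_((a, b), (c, d)) =
  lext (fun xy => 'f_((a, xy.1), (xy.2, d))) (h 'f_(b, c))
  :> {malg F[((K * K) * (K * K))%type]}.
Proof.
rewrite /midmap /= assoclU tmapU /= assocrU tmapU /=.
(* All that follows [h] is the linear insertion $z\mapsto a\otimes z\otimes d$, so a comparison on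
   basis pairs is enough. *)
pose f := assocr \o tensr 'f_d \o assocl \o tens 'f_a
  : {malg F[(K * K)%type]} -> {malg F[((K * K) * (K * K))%type]}.
rewrite -[LHS]/(f (h 'f_(b, c))).
apply: eq_linear => -[x y].
by rewrite /f /= tensUU assoclU /tensr tensUU assocrU lext_bas.
Qed.

End TensorTheory.

(** * Splittings of a finite set and p-binomial sums *)

Lemma big_fsetU {K : choiceType} {M : nmodType} (A C : {fset K}) (f : K -> M) :
  [disjoint A & C]%fset ->
  \sum_(k <- A `|` C) f k = \sum_(k <- A) f k + \sum_(k <- C) f k.
Proof.
move=> dAC; rewrite -big_cat; apply/perm_big/uniq_perm => [||k].
- exact: fset_uniq.
- rewrite cat_uniq !fset_uniq andbT; apply/hasPn => k kC.
  by apply: contraL kC; apply/fdisjointP.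
by rewrite mem_cat in_fsetU.
Qed.

Section Splits.
Context {K : choiceType} {M : zmodType}.
Implicit Types (A C D E : {fset K}) (h : {fset K} -> {fset K} -> M).

(** Sum over the ordered splittings $E=A\sqcup C$. Passing the complement to [h] lets both parts be
    treated alike, and [eq_ssum] recovers that they are disjoint with union $E$. *)
Definition ssum E h : M := \sum_(A <- fpowerset E) h A (E `\` A).

Lemma eq_ssum E h h' :
  (forall A C, E = A `|` C -> [disjoint A & C]%fset -> h A C = h' A C) ->
  ssum E h = ssum E h'.
Proof.
move=> hh'; rewrite /ssum big_seq [RHS]big_seq; apply: eq_bigr => A.
rewrite fpowersetE => sAE; apply: hh'.
  by rewrite fsetUDl fsetDv fsetD0; apply/esym/fsetUidPr.
by apply/fdisjointP => a aA; rewrite in_fsetD aA.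
Qed.

Lemma ssum0 h : ssum fset0 h = h fset0 fset0.
Proof. by rewrite /ssum fpowerset0 big_seq_fset1 fsetD0. Qed.

(** The new element joins either the second part or the first. Inductions on $E$ below rest on this
    two-term recursion. *)
Lemma ssumU1 a E h : a \notin E ->
  ssum (a |` E) h = ssum E (fun A C => h A (a |` C) + h (a |` A) C).
Proof.
move=> aNE; rewrite /ssum big_split /=.
have -> : fpowerset (a |` E) = fpowerset E `|` [fset a |` A | A in fpowerset E].
  apply/fsetP => A; rewrite in_fsetU !fpowersetE; apply/idP/idP.
    move=> sA; have [aA|aNA] := boolP (a \in A); last first.
      apply/orP; left; apply/fsubsetP => b bA.
      move/fsubsetP: sA => /(_ b bA); rewrite in_fset1U => /orP[/eqP ba|//].
      by rewrite ba (negPf aNA) in bA *.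
    apply/orP; right; apply/imfsetP; exists (A `\ a); rewrite /= ?fsetD1K //.
    by rewrite fpowersetE fsubDset.
  move=> /orP[sA|/imfsetP[C /=]].
    by apply: (fsubset_trans sA); apply: fsubsetU1.
  by rewrite fpowersetE => sC ->; apply: fsetUS.
have NA A : A \in fpowerset E -> a \notin A.
  by rewrite fpowersetE => /fsubsetP sA; apply: contra aNE => /sA.
rewrite big_fsetU /=; last first.
  apply/fdisjointP => A /NA aNA; apply/imfsetP => -[C /= _ eA].
  by rewrite eA fset1U1 in aNA.
rewrite [X in _ + X]big_imfset /=; last first.
  move=> A C /NA aNA /NA aNC eAC.
  by rewrite -(fsetU1K aNA) eAC fsetU1K.
congr (_ + _); rewrite big_seq [RHS]big_seq; apply: eq_bigr => A /NA aNA.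
  congr h; apply/fsetP => b; rewrite !inE; case: eqP => [->|//].
  by rewrite aNA.
congr h; apply/fsetP => b; rewrite !inE; case: eqP => [->|//].
by rewrite (negPf aNE) andbF.
Qed.

Lemma ssum_split E h h' :
  ssum E (fun A C => h A C + h' A C) = ssum E h + ssum E h'.
Proof. exact: big_split. Qed.

End Splits.

Lemma ssum_exchange {K : choiceType} {M : zmodType} (D E : {fset K})
    (h : {fset K} -> {fset K} -> {fset K} -> {fset K} -> M) :
  ssum D (fun A C => ssum E (h A C)) =
  ssum E (fun A' C' => ssum D (fun A C => h A C A' C')).
Proof. exact: exchange_big. Qed.

Lemma sum_ssum {K : choiceType} {M : zmodType} (I : Type) (r : seq I)
    (P : pred I) (E : {fset K}) (h : I -> {fset K} -> {fset K} -> M) :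
  \sum_(i <- r | P i) ssum E (h i) = ssum E (fun A C => \sum_(i <- r | P i) h i A C).
Proof. exact: exchange_big. Qed.

(** * Finite subsets of a linear order and inversions between them *)

Section OrderedSets.
Context {disp : Order.disp_t} {B : orderType disp}.
Implicit Types (a b : B) (A C D E : {fset B}).

Definition below a E := forall b, b \in E -> (a < b)%O.

Lemma below_notin a E : below a E -> a \notin E.
Proof. by move=> aE; apply/negP => /aE; rewrite ltxx. Qed.

(** Induction along the increasing list of elements. Adding a new minimum is the convenient step
    because $f_a f_E=f_{\{a\}\cup E}$ then holds without a sign. *)
Lemma fset_min_ind (P : {fset B} -> Prop) :
  P fset0 -> (forall a E, below a E -> P E -> P (a |` E)) -> forall E, P E.
Proof.
move=> P0 PS E.
have -> : E = [fset b in sort <=%O E].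
  by apply/fsetP => b; rewrite in_fset /= mem_sort.
have : sorted <%O (sort <=%O E) by rewrite sort_lt_sorted fset_uniq.
elim: (sort _ _) => [|a w IHw] /=.
  by rewrite (_ : [fset _ | _ in _] = fset0) //; apply/fsetP => b; rewrite !inE.
move=> aw; have -> : [fset b in a :: w] = a |` [fset b in w].
  by apply/fsetP => b; rewrite !inE.
apply: PS; last by apply: IHw; apply: path_sorted aw.
move=> b; rewrite in_fset /=; move: b; apply/allP.
by apply: order_path_min aw; apply: lt_trans.
Qed.

Lemma belowU a A C : below a (A `|` C) <-> below a A /\ below a C.
Proof.
split=> [aAC|[aA aC] b]; last by rewrite in_fsetU => /orP[/aA|/aC].
by split=> b bA; apply: aAC; rewrite in_fsetU bA ?orbT.
Qed.

(** Both sides run over the ordered splittings of $E$ into three parts; this is coassociativity at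
    the level of index sets. *)
Lemma ssum_assoc {M : zmodType} (G : {fset B} -> {fset B} -> {fset B} -> M) E :
  ssum E (fun A C => ssum A (fun A1 A2 => G A1 A2 C)) =
  ssum E (fun A C => ssum C (fun C1 C2 => G A C1 C2)).
Proof.
elim/fset_min_ind: E G => [|a E aE IHE] G; first by rewrite !ssum0.
have aNE := below_notin aE; rewrite !ssumU1 //.
under eq_ssum => A C eE dAC.
  have /belowU[/below_notin aNA _] : below a (A `|` C) by rewrite -eE.
  rewrite ssumU1 // -ssum_split /=.
  over.
under [RHS]eq_ssum => A C eE dAC.
  have /belowU[_ /below_notin aNC] : below a (A `|` C) by rewrite -eE.
  rewrite ssumU1 // -ssum_split /=.
  over.
(* The three summands put the new minimum into the last, the middle and the first part. *)
rewrite (IHE (fun A1 A2 C => G A1 A2 (a |` C) + (G A1 (a |` A2) C + G (a |` A1) A2 C))).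
by apply: eq_ssum => A C _ _; apply: eq_ssum => A' C' _ _; rewrite addrA.
Qed.

Definition inv A C : nat := (\sum_(a <- A) \sum_(b <- C) (b < a)%O)%N.

Lemma inv0l C : inv fset0 C = 0%N. Proof. by rewrite /inv big_seq_fset0. Qed.

Lemma inv0r A : inv A fset0 = 0%N.
Proof. by rewrite /inv big1 // => a _; rewrite big_seq_fset0. Qed.

Lemma invUl A A' C : [disjoint A & A']%fset ->
  inv (A `|` A') C = (inv A C + inv A' C)%N.
Proof. by move=> dA; rewrite /inv big_fsetU. Qed.

Lemma invUr A C C' : [disjoint C & C']%fset ->
  inv A (C `|` C') = (inv A C + inv A C')%N.
Proof.
move=> dC; rewrite /inv -big_split /=; apply: eq_bigr => a _.
by rewrite big_fsetU.
Qed.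

Lemma inv1l a C : below a C -> inv [fset a] C = 0%N.
Proof.
move=> aC; rewrite /inv big_seq_fset1 big_seq big1 // => b /aC ab.
by rewrite lt_gtF.
Qed.

Lemma inv1r a A : below a A -> inv A [fset a] = #|` A|.
Proof.
move=> aA; rewrite /inv big_seq (eq_bigr (fun=> 1%N)) => [|b /aA ab].
  by rewrite -big_seq sum1_size.
by rewrite big_seq_fset1 ab.
Qed.

Lemma invU1l a A C : below a A -> below a C -> inv (a |` A) C = inv A C.
Proof.
move=> /below_notin aNA aC.
by rewrite invUl ?fdisjoint1X // inv1l.
Qed.

Lemma invU1r a A C : below a A -> below a C ->
  inv A (a |` C) = (#|` A| + inv A C)%N.
Proof.
move=> aA /below_notin aNC.
by rewrite invUr ?fdisjoint1X // inv1r.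
Qed.

Lemma cardfsU1N a E : a \notin E -> #|` a |` E| = #|` E|.+1.
Proof. by move=> aNE; rewrite cardfsU1 aNE. Qed.

End OrderedSets.

(** * The $p$-binomial theorem as a sum over splittings *)

Section PShuffle.
Context {disp : Order.disp_t} {B : orderType disp} {F : fieldType}.
Variable p : F.
Implicit Types (E : {fset B}) (h : nat -> F).

(** This is $\sum_k\binom{|E|}{k}_p h(k)$: the $k$-element parts $A$, weighted by
    $p^{\mathrm{inv}(A,C)}$, add up to a $p$-binomial coefficient. In this form no $p$-factorial is
    divided by. *)
Definition shuffle_sum E h : F :=
  ssum E (fun A C => p ^+ inv A C * h #|` A|).

Lemma eq_shuffle_sum E h h' : h =1 h' -> shuffle_sum E h = shuffle_sum E h'.
Proof. by move=> hh; apply: eq_ssum => A C _ _; rewrite hh. Qed.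

Lemma shuffle_sum0 h : shuffle_sum fset0 h = h 0%N.
Proof. by rewrite /shuffle_sum ssum0 inv0l mul1r cardfs0. Qed.

(** The $p$-Pascal rule: a new minimum placed in $C$ is inverted with every element of $A$, which
    costs $p^{|A|}$, while placed in $A$ it creates no inversion. *)
Lemma shuffle_sumU1 a E h : below a E ->
  shuffle_sum (a |` E) h = shuffle_sum E (fun k => p ^+ k * h k + h k.+1).
Proof.
move=> aE; rewrite /shuffle_sum ssumU1 ?below_notin //.
apply: eq_ssum => A C eE _; rewrite eE in aE.
have [aA aC] := (belowU _ _ _).1 aE.
by rewrite invU1r // invU1l // cardfsU1N ?below_notin // exprD; ring.
Qed.

Lemma shuffle_sum_mull E c h : shuffle_sum E (fun k => c * h k) = c * shuffle_sum E h.
Proof. by rewrite /shuffle_sum /ssum mulr_sumr; apply: eq_bigr => A _; ring. Qed.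

Lemma pochp_recl x n : pochp x p n.+1 = (1 - x) * pochp (x * p) p n.
Proof.
rewrite /pochp big_ord_recl expr0 mulr1; congr (_ * _).
by apply: eq_bigr => i _; rewrite /bump /= exprS; ring.
Qed.

Lemma pochp1 n : (0 < n)%N -> pochp 1 p n = 0.
Proof. by case: n => // n _; rewrite pochp_recl subrr mul0r. Qed.

Lemma gammapS k : gammap p k.+1 = - (p ^+ k * gammap p k).
Proof.
rewrite /gammap; have -> : ((k.+1 * k)./2 = (k * k.-1)./2 + k)%N.
  by rewrite -[in LHS](bin2 k.+1) -bin2 binS bin1.
by rewrite exprS exprD; ring.
Qed.

(** The $p$-binomial theorem. As $\gamma_{k+1}=-p^k\gamma_k$, the Pascal rule turns the weight
    $\gamma_kx^k$ into $(1-x)\gamma_k(xp)^k$, which matches $(x;p)_{n+1}=(1-x)(xp;p)_n$; hence the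
    induction is over all $x$ at once. *)
Lemma shuffle_sum_gamma E x :
  shuffle_sum E (fun k => gammap p k * x ^+ k) = pochp x p #|` E|.
Proof.
elim/(@fset_min_ind disp): E x => [|a E aE IHE] x.
  by rewrite shuffle_sum0 cardfs0 /pochp big_ord0 /gammap /= !mul1r.
rewrite shuffle_sumU1 // cardfsU1N ?below_notin // pochp_recl -IHE.
rewrite -shuffle_sum_mull; apply: eq_shuffle_sum => k.
by rewrite gammapS exprS exprMn; ring.
Qed.

(** Indicator weights single out one $p$-binomial coefficient. Lower indices $0$ and $|E|$ serve the
    inductions for $1$ and $|E|-1$, whose value $[n]_p$ appears when $L$ or $R$ is iterated. *)
Lemma shuffle_sum_eq0 E : shuffle_sum E (fun k => (k == 0%N)%:R) = 1.
Proof.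
elim/(@fset_min_ind disp): E => [|a E aE IHE]; first by rewrite shuffle_sum0.
rewrite shuffle_sumU1 // -[RHS]IHE; apply: eq_shuffle_sum => -[|k];
by rewrite ?expr0 /= ?mulr0 ?mulr1 addr0.
Qed.

Lemma numberpS n : numberp p n.+1 = p * numberp p n + 1.
Proof.
rewrite /numberp big_ord_recl expr0 addrC mulr_sumr; congr (_ + _).
by apply: eq_bigr => i _; rewrite exprS.
Qed.

Lemma numberpSr n : numberp p n.+1 = numberp p n + p ^+ n.
Proof. by rewrite /numberp big_ord_recr. Qed.

Lemma shuffle_sum_eq1 E :
  shuffle_sum E (fun k => (k == 1%N)%:R) = numberp p #|` E|.
Proof.
elim/(@fset_min_ind disp): E => [|a E aE IHE].
  by rewrite shuffle_sum0 cardfs0 /numberp big_ord0.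
rewrite shuffle_sumU1 // cardfsU1N ?below_notin // numberpS -IHE.
rewrite -shuffle_sum_mull -[X in _ + X](shuffle_sum_eq0 E) /shuffle_sum -ssum_split.
apply: eq_ssum => A C _ _.
by case: #|` A| => [|[|k]] /=; rewrite ?mulr1n ?mulr0n; ring.
Qed.

Lemma shuffle_sum_card E : shuffle_sum E (fun k => (k == #|` E|)%:R) = 1.
Proof.
elim/(@fset_min_ind disp): E => [|a E aE IHE]; first by rewrite shuffle_sum0 cardfs0.
rewrite shuffle_sumU1 // cardfsU1N ?below_notin // -[RHS]IHE.
apply: eq_ssum => A C -> _; rewrite eqSS.
case: eqP => [eA|_]; last by rewrite mulr0 add0r.
by have := fsubset_leq_card (fsubsetUl A C); rewrite eA ltnn.
Qed.

Lemma shuffle_sum_pred E n : #|` E| = n.+1 ->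
  shuffle_sum E (fun k => (k == n)%:R) = numberp p n.+1.
Proof.
elim/(@fset_min_ind disp): E n => [|a E aE IHE] n; first by rewrite cardfs0.
rewrite shuffle_sumU1 // cardfsU1N ?below_notin // => -[eE].
rewrite numberpSr -[p ^+ n]mulr1 -[X in _ * X](shuffle_sum_card E).
rewrite -shuffle_sum_mull eE.
(* The induction hypothesis speaks of positive cardinality only, so the case of empty $E$ is
   computed directly. *)
case: n eE => [|n] eE.
  rewrite /numberp big_ord0 add0r; apply: eq_shuffle_sum => -[|k] /=.
    by rewrite !mul1r addr0.
  by rewrite !mulr0 addr0.
rewrite -(IHE n eE) /shuffle_sum -ssum_split.
apply: eq_ssum => A C _ _; rewrite eqSS.
by case: eqP => [->|_]; rewrite ?mulr0; ring.
Qed.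

End PShuffle.

(** * The exterior product and the braiding *)

HB.lock Definition mul (disp : Order.disp_t) (B : orderType disp) (F : fieldType)
  (x y : Lam F B) : Lam F B := nabla (tens x y).
Arguments mul {disp B F} x y.

Section ExteriorProduct.
Context {disp : Order.disp_t} {B : orderType disp} {F : fieldType}.
Implicit Types (a b : B) (A C D E : {fset B}) (x y z : Lam F B).

HB.instance Definition _ :=
  GRing.isLinear.Build F _ _ *:%R (@nabla disp B F) (lext_is_linear _).

HB.instance Definition _ :=
  GRing.isLinear.Build F _ _ *:%R (@incl disp B F) (lext_is_linear _).

HB.instance Definition _ k :=
  GRing.isLinear.Build F _ _ *:%R (@piL disp B F k) (lext_is_linear _).

HB.instance Definition _ t :=
  GRing.isLinear.Build F _ _ *:%R (@phi disp B F t) (lext_is_linear _).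

Lemma inclU a : incl 'f_a = 'f_[fset a] :> Lam F B.
Proof. by rewrite /incl lext_bas basE. Qed.

Lemma piLU k A :
  piL k 'f_A = (#|` A| == k)%:R *: 'f_A :> Lam F B.
Proof. by rewrite /piL lext_bas basE; case: eqP; rewrite ?scale1r ?scale0r. Qed.

Lemma phiU t A : phi t 'f_A = t ^+ #|` A| *: 'f_A :> Lam F B.
Proof. by rewrite /phi lext_bas basE. Qed.

Lemma tauU p a b : tau p 'f_(a, b) =
  if a == b then - 'f_(a, a)
  else if (b < a)%O then - (1 - p) *: 'f_(a, b) - 'f_(b, a)
  else - p *: 'f_(b, a) :> {malg F[(B * B)%type]}.
Proof. by rewrite /tau lext_bas !basE. Qed.

Lemma nabla_wedge A C :
  nabla 'f_(A, C) = wedge (sort <=%O A ++ sort <=%O C) :> Lam F B.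
Proof. by rewrite /nabla lext_bas. Qed.

Lemma wedge_bas (s : seq B) :
  wedge s = (if uniq s then (-1) ^+ inversions s *: 'f_[fset b in s] else 0) :> Lam F B.
Proof. by rewrite -basE. Qed.

Lemma oneLE : oneL = 'f_fset0 :> Lam F B.
Proof. exact: basE. Qed.

Lemma mulE x y : mul x y = nabla (tens x y).
Proof. by rewrite unlock. Qed.

Fact mul_is_linear x : linear (mul x).
Proof. by move=> c y z; rewrite !mulE linearP /= linearP. Qed.

HB.instance Definition _ x :=
  GRing.isLinear.Build F _ _ *:%R (mul x) (mul_is_linear x).

Definition rmul y x : Lam F B := mul x y.

Fact rmul_is_linear y : linear (rmul y).
Proof. by move=> c x z; rewrite /rmul !mulE -[tens (_ + _) y]/(tensr y _) !linearP. Qed.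

HB.instance Definition _ y :=
  GRing.isLinear.Build F _ _ *:%R (rmul y) (rmul_is_linear y).

Lemma mulZl c x y : mul (c *: x) y = c *: mul x y.
Proof. exact: (linearZ_LR (rmul y)). Qed.

Lemma mulZr c x y : mul x (c *: y) = c *: mul x y.
Proof. exact: linearZ_LR. Qed.

Lemma mulBl x y z : mul (x - y) z = mul x z - mul y z.
Proof. exact: (linearB (rmul z)). Qed.

Lemma nablaZ c (x : Lam2 F B) : nabla (c *: x) = c *: nabla x.
Proof. exact: linearZ_LR. Qed.

Lemma inversions_cat (s1 s2 : seq B) :
  inversions (s1 ++ s2) =
  (inversions s1 + inversions s2 + \sum_(a <- s1) count (fun b => b < a)%O s2)%N.
Proof.
elim: s1 => [|a s1 IH] /=; first by rewrite big_nil addn0.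
by rewrite IH count_cat big_cons; lia.
Qed.

Lemma inversions_sort (A : {fset B}) : inversions (sort <=%O A) = 0%N.
Proof.
have : sorted <=%O (sort <=%O A) by apply/sort_sorted/le_total.
elim: (sort _ _) => //= a s IHs ps; rewrite IHs ?(path_sorted ps) // addn0.
apply/eqP; rewrite -leqn0 leqNgt -has_count; apply/hasPn => b bs.
rewrite -leNgt; apply: (allP (order_path_min _ ps)) => //.
exact: le_trans.
Qed.

Definition mulc A C : F := if [disjoint A & C]%fset then (-1) ^+ inv A C else 0.

(** The two sorted halves have no inversions of their own, so the sign comes from the pairs across
    them; a letter repeats exactly when $A$ and $C$ meet. *)
Lemma nablaU A C : nabla 'f_(A, C) = mulc A C *: 'f_(A `|` C).
Proof.
rewrite nabla_wedge wedge_bas /mulc cat_uniq !sort_uniq !fset_uniq andbT /=.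
have -> : ~~ has (mem (sort <=%O A)) (sort <=%O C) = [disjoint A & C]%fset.
  apply/hasPn/fdisjointP => dAC b; first last.
    by rewrite /= !mem_sort; apply: contraL; apply: dAC.
  by move=> bA; apply/negP => bC; have := dAC b; rewrite /= !mem_sort bA bC => /(_ isT).
case: ifP => _; last by rewrite scale0r.
rewrite inversions_cat !inversions_sort !add0n; congr (_ ^+ _ *: 'f_ _).
  rewrite /inv (perm_big A) /= ?perm_sort //; apply: eq_bigr => a _.
  by rewrite -sum1_count big_mkcond /= (perm_big C) /= ?perm_sort //.
by apply/fsetP => b; rewrite in_fset /= mem_cat !mem_sort in_fsetU.
Qed.

Lemma mul_nabla A C : mul 'f_A 'f_C = nabla 'f_(A, C) :> Lam F B.
Proof. by rewrite mulE tensUU. Qed.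

Lemma mulUU A C : mul 'f_A 'f_C = mulc A C *: 'f_(A `|` C).
Proof. by rewrite mul_nabla nablaU. Qed.

Lemma mul1x x : mul 'f_fset0 x = x.
Proof.
apply: (@eq_linear _ _ _ (mul 'f_fset0) idfun) => A /=.
by rewrite mulUU /mulc fdisjoint0X inv0l expr0 scale1r fset0U.
Qed.

Lemma mulx1 x : mul x 'f_fset0 = x.
Proof.
apply: (@eq_linear _ _ _ (rmul 'f_fset0) idfun) => A /=.
by rewrite /rmul mulUU /mulc fdisjointX0 inv0r expr0 scale1r fsetU0.
Qed.

Lemma mul1U a A : below a A -> mul 'f_[fset a] 'f_A = 'f_(a |` A) :> Lam F B.
Proof.
move=> aA; rewrite mulUU /mulc fdisjoint1X below_notin // inv1l //.
by rewrite expr0 scale1r.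
Qed.

Lemma mulA x y z : mul (mul x y) z = mul x (mul y z).
Proof.
apply: (@eq_linear _ _ _ (rmul z \o rmul y) (rmul (mul y z))) => A /=.
rewrite /rmul; apply: (@eq_linear _ _ _ (rmul z \o mul _) (mul _ \o rmul z)) => C.
rewrite /= /rmul; apply: (@eq_linear _ _ _ (mul (mul _ _)) (mul _ \o mul _)) => D /=.
rewrite mulUU mulUU mulZl mulZr !mulUU !scalerA fsetUA; congr (_ *: _).
rewrite /mulc fdisjointUX fdisjointXU.
case: (boolP [disjoint A & C]%fset) => dAC /=; last by rewrite mul0r mulr0.
case: (boolP [disjoint C & D]%fset) => dCD /=; last by rewrite andbF mul0r mulr0.
case: (boolP [disjoint A & D]%fset) => dAD /=; last by rewrite !mulr0.
by rewrite invUl // invUr // !exprD; ring.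
Qed.

Definition deg m : pred {fset B} := fun A => #|` A| == m.
Definition deg2 m n : pred ({fset B} * {fset B}) :=
  fun k => deg m k.1 && deg n k.2.

Lemma supported_tens (P Q : pred {fset B}) x y :
  supported P x -> supported Q y ->
  supported (fun k => P k.1 && Q k.2) (tens x y).
Proof.
move=> Px Qy; apply: (supported_linear (f := tensr y) Px) => A PA.
rewrite /tensr; apply: (supported_linear (f := tens 'f_A) Qy) => C QC.
by rewrite /= tensUU; apply: supportedU; rewrite /= PA.
Qed.

Lemma supported_mul m n A C : deg m A -> deg n C ->
  supported (deg (m + n)%N) (mul 'f_A 'f_C : Lam F B).
Proof.
move=> /eqP<- /eqP<-; rewrite mulUU /mulc; case: ifP => dAC; last first.
  by rewrite scale0r; apply: supported0.
by apply/supportedZ/supportedU; rewrite /deg cardfsU (eqP dAC) cardfs0 subn0.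
Qed.

(** The outer factors of the fourfold tensor are untouched by [midmap h], so after multiplying they
    act as a left and a right multiplication. *)
Lemma nabla_midmapU (h : Lam2 F B -> Lam2 F B) A C D E :
  (nabla ⊗ nabla) (midmap h 'f_((A, C), (D, E))) =
  (mul 'f_A ⊗ rmul 'f_E) (h 'f_(C, D)).
Proof.
rewrite midmapU.
apply: (@eq_linear _ _ _ ((nabla ⊗ nabla) \o lext _) (mul _ ⊗ rmul _)) => -[x y].
by rewrite /= lext_bas !tmapU /= /rmul !mul_nabla.
Qed.

(** * The braiding, one letter at a time *)

Section Braiding.
Variables (p : F) (T : {linear Lam2 F B -> Lam2 F B}).
Hypothesis hT : is_braiding p T.

Lemma braid0l A : T 'f_(fset0, A) = 'f_(A, fset0).
Proof. by rewrite -!tensUU -oneLE (braiding_1l hT). Qed.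

Lemma braid0r A : T 'f_(A, fset0) = 'f_(fset0, A).
Proof. by rewrite -!tensUU -oneLE (braiding_1r hT). Qed.

(** A hexagon relation: in the compatibility of the braiding with the product, the first of the four
    factors is set to $1$, and two of the four crossings become trivial. The mirror relation
    [braid_mull] sets the last factor to $1$. *)
Lemma braid_mulr E A C :
  T (tens 'f_E (mul 'f_A 'f_C)) =
  lext (fun k => (mul 'f_(k.1) ⊗ idfun) (T 'f_(k.2, C))) (T 'f_(E, A)).
Proof.
have := braiding_nabla hT 'f_((fset0, E), (A, C)).
rewrite /= tmapU -!mul_nabla mul1x => ->.
rewrite midmapU; set f := lext _; set g := lext _.
apply: (@eq_linear _ _ _ ((nabla ⊗ nabla) \o midmap T \o (T ⊗ T) \o f) g).
move=> -[x y]; rewrite /f /g /= !lext_bas /= tmapU braid0l.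
apply: (@eq_linear _ _ _ ((nabla ⊗ nabla) \o midmap T \o tens _) (mul _ ⊗ _)).
move=> -[u v]; rewrite /= tensUU nabla_midmapU braid0l !tmapU /= /rmul.
by rewrite mul1x.
Qed.

Lemma braid_mull D E A :
  T (tens (mul 'f_D 'f_E) 'f_A) =
  lext (fun k => (idfun ⊗ rmul 'f_(k.2)) (T 'f_(D, k.1))) (T 'f_(E, A)).
Proof.
have := braiding_nabla hT 'f_((D, E), (A, fset0)).
rewrite /= tmapU -!mul_nabla mulx1 => ->.
rewrite midmapU; set f := lext _; set g := lext _.
apply: (@eq_linear _ _ _ ((nabla ⊗ nabla) \o midmap T \o (T ⊗ T) \o f) g).
move=> -[x y]; rewrite /f /g /= !lext_bas /= tmapU braid0r.
apply: (@eq_linear _ _ _ ((nabla ⊗ nabla) \o midmap T \o tensr _) (_ ⊗ rmul _)).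
move=> -[u v]; rewrite /= /tensr tensUU nabla_midmapU braid0r !tmapU /= /rmul.
by rewrite mulx1.
Qed.

Lemma braid_letters a b :
  T 'f_([fset a], [fset b]) = (incl ⊗ incl) (tau p 'f_(a, b)).
Proof. by have := braiding_V hT 'f_(a, b); rewrite /= tmapU !inclU tensUU. Qed.

Lemma braid_letters_lt a b : (a < b)%O ->
  T 'f_([fset a], [fset b]) = - p *: 'f_([fset b], [fset a]).
Proof.
move=> ab; rewrite braid_letters tauU (lt_eqF ab) (lt_gtF ab).
by rewrite tmapZ tmapU !inclU tensUU.
Qed.

Lemma braid_letters_deg a b : supported (deg2 1 1) (T 'f_([fset a], [fset b])).
Proof.
have sU c d : supported (deg2 1 1) ((incl ⊗ incl) 'f_(c, d) : Lam2 F B).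
  rewrite tmapU !inclU tensUU; apply: supportedU.
  by rewrite /deg2 /deg /= !cardfs1.
rewrite braid_letters tauU; case: eqP => [->|_].
  by rewrite linearN; apply/supportedN/sU.
case: ifP => _; last by rewrite linearZ /=; apply/supportedZ/sU.
rewrite linearB linearZ /=.
by apply: supportedD; [apply/supportedZ/sU | apply/supportedN/sU].
Qed.

(** For $a>b$, anticommutativity gives $-(1-p)ab-ba=p\,ab$; for $a<b$ it gives $-p\,ba=p\,ab$; for
    $a=b$ both sides vanish. *)
Lemma nabla_braid_letters a b :
  nabla (T 'f_([fset a], [fset b])) = p *: nabla 'f_([fset a], [fset b]).
Proof.
have anti c d : (c < d)%O ->
    nabla 'f_([fset d], [fset c]) = - nabla 'f_([fset c], [fset d]) :> Lam F B.
  move=> cd; have bcd : below c [fset d] by move=> e; rewrite in_fset1 => /eqP->.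
  rewrite !nablaU /mulc !fdisjoint1X !in_fset1 (lt_eqF cd) (gt_eqF cd) /=.
  rewrite (inv1l bcd) (inv1r bcd) cardfs1 expr0 expr1 scale1r scaleN1r.
  by rewrite fsetUC.
have [ab|ba|<-] := ltgtP a b.
- by rewrite braid_letters_lt // nablaZ (anti a b ab) scalerN scaleNr opprK.
- rewrite braid_letters tauU (gt_eqF ba) ba linearB linearZ /=.
  rewrite !tmapU !inclU !tensUU linearB linearZ /= (anti b a ba).
  by rewrite scaleNr !scalerN opprK scalerBl scale1r addrAC subrr add0r.
rewrite braid_letters tauU eqxx linearN /= tmapU !inclU tensUU linearN /=.
by rewrite nablaU /mulc fdisjoint1X in_fset1 eqxx !scale0r scaler0 oppr0.
Qed.

(** A letter below all of $A$ meets only the one-term case $\tau(a\otimes b)=-p\,b\otimes a$, so it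
    passes through with a factor $-p$ per letter. *)
Lemma braid_letter_below a A : below a A ->
  T 'f_([fset a], A) = (- p) ^+ #|` A| *: 'f_(A, [fset a]).
Proof.
elim/(@fset_min_ind disp): A => [|b A bA IHA].
  by rewrite braid0r cardfs0 expr0 scale1r.
move=> /belowU[ab aA]; rewrite -tensUU -(mul1U bA) braid_mulr.
have ab' : (a < b)%O by apply: ab; rewrite in_fset1.
rewrite (braid_letters_lt ab') lextZ lext_bas /= (IHA aA).
rewrite tmapZ tmapU /= (mul1U bA) tensUU scalerA.
by rewrite (cardfsU1N (below_notin bA)) exprS.
Qed.

Lemma braid_letter_deg a A :
  supported (deg2 #|` A| 1) (T 'f_([fset a], A)).
Proof.
elim/(@fset_min_ind disp): A a => [|b A bA IHA] a.
  by rewrite braid0r; apply: supportedU; rewrite /deg2 /deg /= cardfs1 !eqxx.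
rewrite -tensUU -(mul1U bA) braid_mulr; set f := lext _.
apply: (supported_linear (f := f) (@braid_letters_deg a b)) => -[c d] /andP[/= c1].
rewrite /f /= lext_bas /= => /cardfs1P[d' ->].
apply: (supported_linear (f := mul 'f_c ⊗ idfun) (IHA d')) => -[x y] /andP[/= xA y1].
rewrite tmapU; apply: supported_tens; last exact: supportedU.
by rewrite (cardfsU1N (below_notin bA)); apply: (@supported_mul 1).
Qed.

(** The braiding swaps degrees: this holds for two letters, and the hexagon relations extend it
    first in the right factor and then in the left one. *)
Lemma braid_deg E A :
  supported (deg2 #|` A| #|` E|) (T 'f_(E, A)).
Proof.
elim/(@fset_min_ind disp): E A => [|a E aE IHE] A.
  by rewrite braid0l; apply: supportedU; rewrite /deg2 /deg /= !eqxx.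
rewrite -tensUU -(mul1U aE) braid_mull; set f := lext _.
apply: (supported_linear (f := f) (IHE A)) => -[c d] /andP[/= cA dE].
rewrite /f /= lext_bas /=.
apply: (supported_linear (f := idfun ⊗ rmul 'f_d) (@braid_letter_deg a c)) => -[x y].
rewrite (eqP cA) => /andP[/= xA y1]; rewrite tmapU.
apply: supported_tens; first exact: supportedU.
by rewrite (cardfsU1N (below_notin aE)); apply: (@supported_mul 1).
Qed.

Lemma nabla_tmap_mull x (z : Lam2 F B) : nabla ((mul x ⊗ idfun) z) = mul x (nabla z).
Proof.
apply: (@eq_linear _ _ _ (nabla \o mul x ⊗ idfun) (mul x \o nabla)) => -[A C] /=.
by rewrite tmapU /= -mul_nabla -mulE mulA.
Qed.

Lemma nabla_tmap_mulr y (z : Lam2 F B) : nabla ((idfun ⊗ rmul y) z) = rmul y (nabla z).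
Proof.
apply: (@eq_linear _ _ _ (nabla \o idfun ⊗ rmul y) (rmul y \o nabla)) => -[A C] /=.
by rewrite tmapU /= -mul_nabla -mulE /rmul mulA.
Qed.

Lemma nabla_braid_letter a A :
  nabla (T 'f_([fset a], A)) = p ^+ #|` A| *: mul 'f_[fset a] 'f_A.
Proof.
elim/(@fset_min_ind disp): A a => [|b A bA IHA] a.
  by rewrite braid0r -mul_nabla mul1x mulx1 cardfs0 scale1r.
rewrite -tensUU -(mul1U bA) braid_mulr; set f := lext _.
rewrite (cardfsU1N (below_notin bA)) exprSr -scalerA -mulA -mulZl.
rewrite mul_nabla -nabla_braid_letters.
rewrite -[RHS]/((p ^+ #|` A| \*: (rmul 'f_A \o nabla)) (T 'f_([fset a], [fset b]))).
rewrite -[LHS]/((nabla \o f) (T 'f_([fset a], [fset b]))).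
(* In every term of the braided pair the second factor is again a single letter, so the induction
   hypothesis applies to it. *)
apply: (eq_linear_supp (@braid_letters_deg a b)) => -[c d] /andP[/= c1].
move=> /cardfs1P[d' ->]; rewrite /f lext_bas /= nabla_tmap_mull IHA mulZr.
by rewrite -mulA mul_nabla.
Qed.

(** Each letter of $E$ crosses a factor of degree $|A|$ and contributes $p^{|A|}$. Although the
    braiding has many terms, the product sees only this common scalar. *)
Lemma nabla_braid E A :
  nabla (T 'f_(E, A)) = p ^+ (#|` E| * #|` A|) *: mul 'f_E 'f_A.
Proof.
elim/(@fset_min_ind disp): E A => [|a E aE IHE] A.
  by rewrite braid0l -mul_nabla mul1x mulx1 cardfs0 mul0n scale1r.
rewrite -tensUU -(mul1U aE) braid_mull; set f := lext _.
rewrite (cardfsU1N (below_notin aE)) mulSn exprD -scalerA mulA -mulZr -IHE.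
rewrite -[RHS]/((p ^+ #|` A| \*: (mul 'f_[fset a] \o nabla)) (T 'f_(E, A))).
rewrite -[LHS]/((nabla \o f) (T 'f_(E, A))).
apply: (eq_linear_supp (@braid_deg E A)) => -[c d] /andP[/= /eqP cA dE].
rewrite /f lext_bas /= nabla_tmap_mulr nabla_braid_letter cA /rmul mulZl.
by rewrite mulA mul_nabla.
Qed.

End Braiding.
End ExteriorProduct.

(** * The coproduct and the antipode *)

Section SplitExtremes.
Context {K : choiceType} {M : zmodType}.
Implicit Types (A C E : {fset K}) (h : {fset K} -> {fset K} -> M).

Lemma ssum_top E h :
  (forall A C, E = A `|` C -> A != E -> h A C = 0) -> ssum E h = h E fset0.
Proof.
move=> h0; rewrite /ssum (big_fsetD1 E) ?fpowersetE ?fsubset_refl //=.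
rewrite fsetDv big_seq big1 ?addr0 // => A.
rewrite in_fsetD1 fpowersetE => /andP[AE sAE]; apply: h0 => //.
by rewrite fsetUDl fsetDv fsetD0; apply/esym/fsetUidPr.
Qed.

Lemma ssum_bot E h :
  (forall A C, A != fset0 -> h A C = 0) -> ssum E h = h fset0 E.
Proof.
move=> h0; rewrite /ssum (big_fsetD1 fset0) ?fpowersetE ?fsub0set //=.
rewrite fsetD0 big_seq big1 ?addr0 // => A.
by rewrite in_fsetD1 => /andP[A0 _]; apply: h0.
Qed.

Lemma card_split E A C : E = A `|` C -> [disjoint A & C]%fset ->
  #|` E| = (#|` A| + #|` C|)%N.
Proof. by move=> -> dAC; rewrite cardfsU (eqP dAC) cardfs0 subn0. Qed.

End SplitExtremes.

Lemma linear_ssum {F : fieldType} {K : choiceType} {M N : lmodType F}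
    (f : {linear M -> N}) (E : {fset K}) h :
  f (ssum E h) = ssum E (fun A C => f (h A C)).
Proof. exact: linear_sum. Qed.

Lemma scaler_ssum {F : fieldType} {K : choiceType} {M : lmodType F} c
    (E : {fset K}) (h : {fset K} -> {fset K} -> M) :
  c *: ssum E h = ssum E (fun A C => c *: h A C).
Proof. exact: scaler_sumr. Qed.

Lemma ssum_scalel {F : fieldType} {K : choiceType} {M : lmodType F}
    (E : {fset K}) (h : {fset K} -> {fset K} -> F) (v : M) :
  ssum E h *: v = ssum E (fun A C => h A C *: v).
Proof. exact: scaler_suml. Qed.

HB.instance Definition _ {disp : Order.disp_t} {B : orderType disp} {F : fieldType} :=
  GRing.isLinear.Build F _ _ *:%R (@nabla2 disp B F)
    (linearP (nabla \o (nabla ⊗ idfun))).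

Section Coproduct.
Context {disp : Order.disp_t} {B : orderType disp} {F : fieldType}.
Implicit Types (a b : B) (A C D E G X Y : {fset B}) (w x y z : Lam F B).
Variables (p : F) (T : {linear Lam2 F B -> Lam2 F B}).
Hypothesis hT : is_braiding p T.
Variable Delta : {linear Lam F B -> Lam2 F B}.
Hypothesis hDelta : is_coproduct T Delta.

(** In $\Delta(f_a)\Delta(f_E)$ the summand $a\otimes1$ puts $a$ in front of $A$ with no
    coefficient, while in $1\otimes a$ the letter first crosses $A$ and gains $(-p)^{|A|}$, the
    growth of the inversion count when $a$ joins $C$. *)
Lemma coproductU E :
  Delta 'f_E = ssum E (fun A C => (- p) ^+ inv A C *: 'f_(A, C)).
Proof.
elim/(@fset_min_ind disp): E => [|a E aE IHE].
  by rewrite -oneLE (coproduct_1 hDelta) ssum0 inv0l expr0 scale1r oneLE tensUU.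
rewrite -(mul1U aE) mul_nabla.
have /= -> := coproduct_nabla hDelta 'f_([fset a], E).
rewrite tmapU IHE (ssumU1 _ (below_notin aE)).
pose f := (nabla ⊗ nabla) \o midmap T \o tens (Delta 'f_[fset a]).
rewrite -[LHS]/(f (ssum _ _)) [LHS](linear_ssum f); apply: eq_ssum => A C eE dAC.
have /belowU[aA aC] : below a (A `|` C) by rewrite -eE.
rewrite linearZ_LR /f /= -inclU (coproduct_V hDelta) !inclU oneLE !tensUU.
pose g := (nabla ⊗ nabla) \o midmap T \o tensr 'f_(A, C).
rewrite -[_ (midmap _ _)]/(g _) [X in _ *: X](linearD g) /g /= /tensr !tensUU.
transitivity ((- p) ^+ inv A C *:
    ('f_(a |` A, C) + (- p) ^+ #|` A| *: 'f_(A, a |` C))); last first.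
  rewrite (invU1r aA aC) (invU1l aA aC) exprD [in RHS]mulrC -scalerA addrC.
  by rewrite scalerDr.
congr (_ *: (_ + _)).
  by rewrite nabla_midmapU (braid0l hT) tmapU (mul1U aA) /rmul mul1x tensUU.
rewrite nabla_midmapU (braid_letter_below hT aA) tmapZ tmapU mul1x.
by rewrite /rmul (mul1U aC) tensUU.
Qed.

Lemma linear_coproduct (M : lmodType F) (f : {linear Lam2 F B -> M}) E :
  f (Delta 'f_E) = ssum E (fun A C => (- p) ^+ inv A C *: f 'f_(A, C)).
Proof.
rewrite coproductU linear_ssum; apply: eq_ssum => A C _ _.
exact: linearZ_LR.
Qed.

Lemma coproduct_mul D G :
  Delta (mul 'f_D 'f_G) =
  ssum D (fun D1 D2 => ssum G (fun G1 G2 =>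
    ((- p) ^+ inv D1 D2 * (- p) ^+ inv G1 G2) *:
      (mul 'f_D1 ⊗ rmul 'f_G2) (T 'f_(D2, G1)))).
Proof.
rewrite mul_nabla; have /= -> := coproduct_nabla hDelta 'f_(D, G).
rewrite tmapU.
pose g := (nabla ⊗ nabla) \o midmap T \o tensr (Delta 'f_G).
rewrite -[LHS]/(g (Delta 'f_D)) [LHS](linear_coproduct g).
apply: eq_ssum => D1 D2 _ _.
pose f := (nabla ⊗ nabla) \o midmap T \o tens 'f_(D1, D2).
rewrite -[X in _ *: X = _]/(f (Delta 'f_G)).
rewrite [X in _ *: X](linear_coproduct f) scaler_ssum.
apply: eq_ssum => G1 G2 _ _.
by rewrite scalerA /f /= tensUU nabla_midmapU.
Qed.

(** The coefficient $(-p)^{\mathrm{inv}}$ of the coproduct and the sign $(-1)^{\mathrm{inv}}$ of the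
    product multiply to $p^{\mathrm{inv}}$, so splitting and multiplying back acts on $f_E$ by a
    $p$-binomial sum. *)
Lemma ssum_mul_shuffle E (h : nat -> F) :
  ssum E (fun A C => ((- p) ^+ inv A C * h #|` A|) *: mul 'f_A 'f_C) =
  shuffle_sum p E h *: 'f_E.
Proof.
rewrite /shuffle_sum ssum_scalel; apply: eq_ssum => A C -> dAC.
rewrite mulUU /mulc dAC scalerA; congr (_ *: _).
by rewrite [LHS]mulrAC -exprMn mulrN1 opprK.
Qed.

Lemma nabla2U A C D : nabla2 'f_(A, C, D) = mul (mul 'f_A 'f_C) 'f_D :> Lam F B.
Proof. by rewrite /nabla2 /= tmapU -mul_nabla -mulE. Qed.

(** * The antipode, $\lambda_R$ and the first form of $\rho$ *)

Section Antipode.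
Variables (S : {linear Lam F B -> Lam F B}).
Hypothesis hS : is_antipode Delta S.

(** The map $f_E\mapsto\gamma_{|E|}f_E$ is also a left convolution inverse of the identity, because
    the $p$-binomial theorem at $x=1$ gives $(1;p)_n=0$ for $n>0$. Uniqueness follows by strong
    induction on $|E|$. *)
Lemma antipodeU E : S 'f_E = gammap p #|` E| *: 'f_E.
Proof.
have [n] := ubnP #|` E|; elim: n E => // n IHn E leEn.
pose h A C := (- p) ^+ inv A C *: mul (S 'f_A - gammap p #|` A| *: 'f_A) 'f_C.
have hE : ssum E h = S 'f_E - gammap p #|` E| *: 'f_E.
  (* Proper subsets $A$ contribute nothing by induction; the remaining term $A=E$ is the difference
     to be shown zero. *)
  rewrite ssum_top => [|A C eE AE].
    by rewrite /h inv0r expr0 scale1r mulx1.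
  rewrite /h IHn ?subrr -/(rmul 'f_C 0) ?linear0 ?scaler0 //.
  have sAE : A `<` E by rewrite fproperEneq AE eE fsubsetUl.
  exact: leq_trans (fproper_ltn_card sAE) leEn.
apply/eqP; rewrite -subr_eq0 -hE; apply/eqP.
transitivity (nabla ((S ⊗ idfun) (Delta 'f_E)) -
  ssum E (fun A C => ((- p) ^+ inv A C * gammap p #|` A|) *: mul 'f_A 'f_C)).
  pose f := nabla \o (S ⊗ idfun).
  rewrite -[X in _ = X - _]/(f (Delta 'f_E)) [X in _ = X - _](linear_coproduct f).
  rewrite -sumrB.
  apply: eq_bigr => A _; rewrite /= tmapU /= -mulE /h mulBl mulZl.
  rewrite scalerBr; congr (_ - _).
  exact: scalerA.
rewrite ssum_mul_shuffle (antipode_l hS) /counit.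
rewrite -(eq_shuffle_sum p E (h := fun k => gammap p k * 1 ^+ k)) => [|k]; last first.
  by rewrite expr1n mulr1.
rewrite shuffle_sum_gamma -basE mcoeffU basE; case: (eqVneq E fset0) => [->|E0].
  by rewrite cardfs0 /pochp big_ord0 oneLE !scale1r subrr.
have cE : (0 < #|` E|)%N by rewrite cardfs_gt0.
rewrite (pochp1 _ cE) mulr0n scale0r [X in _ - X]scale0r; exact: subrr.
Qed.

(** After the braiding the first factor has degree $|A|$, so $S\phi_t$ acts by
    $\gamma_{|A|}t^{|A|}$, and multiplying out the braided pair gives $p^{|Y||A|}$. The sum over $A$
    is the $p$-binomial theorem at $x=tp^{|Y|}$. *)
Lemma lambdaRU t Y G :
  lambdaR T Delta S t 'f_(Y, G) =
  pochp (t * p ^+ #|` Y|) p #|` G| *: mul 'f_Y 'f_G.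
Proof.
pose f := nabla2 \o (((S \o phi t) ⊗ idfun) ⊗ idfun) \o (T ⊗ idfun) \o assocl
  \o tens 'f_Y.
rewrite /lambdaR /= tmapU -[LHS]/(f (Delta 'f_G)) [LHS](linear_coproduct f).
rewrite -(shuffle_sum_gamma _ _) -mulZr -ssum_mul_shuffle (linear_ssum (mul 'f_Y)).
apply: eq_ssum => A C _ _; rewrite /= mulZr -[RHS]scalerA; congr (_ *: _).
rewrite /f /= tensUU assoclU tmapU /= -mulA.
pose c := gammap p #|` A| * t ^+ #|` A|.
transitivity (c *: rmul 'f_C (nabla (T 'f_(Y, A)))); last first.
  by rewrite (nabla_braid hT) /rmul mulZl scalerA exprMn -exprM mulrA.
apply: (@eq_linear_supp _ _ _ _ _
  (nabla2 \o ((((S \o phi t) ⊗ idfun) ⊗ idfun) \o tensr 'f_C))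
  (c \*: (rmul 'f_C \o nabla)) (@braid_deg _ _ _ p T hT Y A)).
move=> -[X X'] /andP[/= /eqP XA _].
rewrite /tensr tensUU !tmapU /= phiU (linearZ_LR S) antipodeU XA scalerA.
by rewrite !tensZl !tensUU [LHS](linearZ_LR nabla2) /= nabla2U mulrC -mul_nabla.
Qed.

(** The braiding of $f_E\otimes f_A$ has bidegree $(|A|,|E|)$, so the scalars from $\phi_t$ and
    $\lambda_R$ are the same for all its terms and can be pulled out. *)
Lemma RmatrixU t E G :
  Rmatrix T Delta S t 'f_(E, G) =
  ssum G (fun A C =>
    (t ^+ #|` A| * pochp (t * p ^+ #|` E|) p #|` C| * (- p) ^+ inv A C) *:
      (idfun ⊗ rmul 'f_C) (T 'f_(E, A))).
Proof.
pose f := (phi t ⊗ lambdaR T Delta S t) \o assocr \o (T ⊗ idfun) \o assocl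
  \o tens 'f_E.
rewrite /Rmatrix /= tmapU -[LHS]/(f (Delta 'f_G)) [LHS](linear_coproduct f).
apply: eq_ssum => A C _ _; rewrite [in RHS]mulrC -[RHS]scalerA; congr (_ *: _).
rewrite /f /= tensUU assoclU tmapU /=.
set c := _ * _.
apply: (@eq_linear_supp _ _ _ _ _
  ((phi t ⊗ lambdaR T Delta S t) \o assocr \o tensr 'f_C)
  (c \*: (idfun ⊗ rmul 'f_C)) (@braid_deg _ _ _ p T hT E A)).
move=> -[X Y] /andP[/= /eqP XA /eqP YE].
rewrite /tensr tensUU assocrU !tmapU lambdaRU phiU XA YE.
by rewrite tensZl tensZr scalerA.
Qed.

End Antipode.
End Coproduct.

(** * Divided powers of L and R *)

Lemma sum_pick {F : fieldType} {M : lmodType F} N n (f : nat -> M) :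
  \sum_(i < N) (n == i :> nat)%:R *: f i = if (n < N)%N then f n else 0.
Proof.
case: ltnP => [nN|Nn].
  rewrite (bigD1 (Ordinal nN)) //= eqxx scale1r big1 ?addr0 // => i.
  by rewrite -val_eqE eq_sym /= => /negPf->; rewrite scale0r.
rewrite big1 // => i _; case: eqP => [ni|_]; last by rewrite scale0r.
by have := ltn_ord i; rewrite -ni ltnNge Nn.
Qed.

Fact linear_comb_is_linear {F : fieldType} {U V : lmodType F} N (c : nat -> F)
    (g : nat -> {linear U -> V}) : linear (fun u => \sum_(k < N) c k *: g k u).
Proof.
move=> d x y; rewrite scaler_sumr -big_split; apply: eq_bigr => k _ /=.
by rewrite linearP scalerDr !scalerA mulrC.
Qed.

Lemma eq_scale {F : fieldType} {M : lmodType F} (c d : F) (x : M) :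
  c = d -> c *: x = d *: x.
Proof. by move=> ->. Qed.

HB.instance Definition _ {disp : Order.disp_t} {B : orderType disp} {F : fieldType}
    (Delta : {linear Lam F B -> Lam2 F B}) k :=
  GRing.isLinear.Build F _ _ *:%R (@Delta_l disp B F Delta k)
    (linearP ((piL k ⊗ idfun) \o Delta)).

HB.instance Definition _ {disp : Order.disp_t} {B : orderType disp} {F : fieldType}
    (Delta : {linear Lam F B -> Lam2 F B}) k :=
  GRing.isLinear.Build F _ _ *:%R (@Delta_r disp B F Delta k)
    (linearP ((idfun ⊗ piL k) \o Delta)).

(** A division-free form of $L^{\langle i\rangle_p}$, convertible to [Lop] for $i=1$; [Rdiv] plays
    the same part for $R$. *)
Definition Ldiv {disp : Order.disp_t} {B : orderType disp} {F : fieldType}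
    (Delta : Lam F B -> Lam2 F B) (i : nat) : Lam2 F B -> Lam2 F B :=
  (nabla ⊗ idfun) \o assocl \o (idfun ⊗ Delta_l Delta i).

Definition Rdiv {disp : Order.disp_t} {B : orderType disp} {F : fieldType}
    (Delta : Lam F B -> Lam2 F B) (j : nat) : Lam2 F B -> Lam2 F B :=
  (idfun ⊗ nabla) \o assocr \o (Delta_r Delta j ⊗ idfun).

HB.instance Definition _ {disp : Order.disp_t} {B : orderType disp} {F : fieldType}
    Delta i :=
  GRing.isLinear.Build F _ _ *:%R (@Ldiv disp B F Delta i)
    (linearP ((nabla ⊗ idfun) \o assocl \o (idfun ⊗ Delta_l Delta i))).

HB.instance Definition _ {disp : Order.disp_t} {B : orderType disp} {F : fieldType}
    Delta j :=
  GRing.isLinear.Build F _ _ *:%R (@Rdiv disp B F Delta j)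
    (linearP ((idfun ⊗ nabla) \o assocr \o (Delta_r Delta j ⊗ idfun))).

(** The sum over $k$ in the componentwise formula, for input with left degree $m$ and output with
    left degree $i$, before the scalar $t^i(tp^m;p)_{n-i}$. *)
Definition LRsum {disp : Order.disp_t} {B : orderType disp} {F : fieldType}
    (Delta : Lam F B -> Lam2 F B) (p : F) (i m : nat) (z : Lam2 F B) : Lam2 F B :=
  \sum_(k < (minn i m).+1)
    gammap p k *: Ldiv Delta (i - k) (Rdiv Delta (m - k) z).

Fact LRsum_is_linear {disp : Order.disp_t} {B : orderType disp} {F : fieldType}
  (Delta : Lam F B -> Lam2 F B) p i m : linear (LRsum Delta p i m).
Proof.
exact: (linear_comb_is_linear _ (gammap p)
  (fun k => Ldiv Delta (i - k) \o Rdiv Delta (m - k))).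
Qed.

HB.instance Definition _ {disp : Order.disp_t} {B : orderType disp} {F : fieldType}
    Delta p i m :=
  GRing.isLinear.Build F _ _ *:%R (@LRsum disp B F Delta p i m)
    (LRsum_is_linear Delta p i m).

Section DividedPowers.
Context {disp : Order.disp_t} {B : orderType disp} {F : fieldType}.
Implicit Types (a b : B) (A C D E G X Y : {fset B}) (w x y : Lam F B) (z : Lam2 F B).
Variables (p : F) (T : {linear Lam2 F B -> Lam2 F B}).
Hypothesis hT : is_braiding p T.
Variable Delta : {linear Lam F B -> Lam2 F B}.
Hypothesis hDelta : is_coproduct T Delta.

Lemma Delta_lU i E : Delta_l Delta i 'f_E =
  ssum E (fun A C => ((#|` A| == i)%:R * (- p) ^+ inv A C) *: 'f_(A, C)).
Proof.
rewrite -[LHS]/((piL i ⊗ idfun) (Delta 'f_E)).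
rewrite [LHS](linear_coproduct hT hDelta); apply: eq_ssum => A C _ _.
by rewrite /= tmapU piLU tensZl tensUU scalerA mulrC.
Qed.

Lemma Delta_rU j E : Delta_r Delta j 'f_E =
  ssum E (fun A C => ((#|` C| == j)%:R * (- p) ^+ inv A C) *: 'f_(A, C)).
Proof.
rewrite -[LHS]/((idfun ⊗ piL j) (Delta 'f_E)).
rewrite [LHS](linear_coproduct hT hDelta); apply: eq_ssum => A C _ _.
by rewrite /= tmapU piLU tensZr tensUU scalerA mulrC.
Qed.

Lemma Ldiv_tensl i C y :
  Ldiv Delta i (tens 'f_C y) = (mul 'f_C ⊗ idfun) (Delta_l Delta i y).
Proof.
rewrite /Ldiv /= tmap_tens /=.
apply: (@eq_linear _ _ _ ((nabla ⊗ idfun) \o assocl \o tens 'f_C)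
  (mul 'f_C ⊗ idfun)) => -[X Y].
by rewrite /= tensUU assoclU !tmapU -mul_nabla.
Qed.

Lemma Ldiv_tensr i w Y :
  Ldiv Delta i (tens w 'f_Y) =
  ssum Y (fun A C => ((#|` A| == i)%:R * (- p) ^+ inv A C) *: tens (mul w 'f_A) 'f_C).
Proof.
rewrite /Ldiv /= tmap_tens /= Delta_lU.
pose f : Lam2 F B -> Lam2 F B := (nabla ⊗ idfun) \o assocl \o tens w.
rewrite -[LHS]/(f (ssum _ _)) [LHS](linear_ssum f); apply: eq_ssum => A C _ _.
rewrite [LHS](linearZ_LR f); congr (_ *: _).
apply: (@eq_linear _ _ _ ((nabla ⊗ idfun) \o assocl \o tensr 'f_(A, C))
  (tensr 'f_C \o rmul 'f_A)) => X.
by rewrite /= /tensr tensUU assoclU tmapU -mul_nabla.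
Qed.

Lemma Rdiv_tensl j X w :
  Rdiv Delta j (tens 'f_X w) =
  ssum X (fun A C => ((#|` C| == j)%:R * (- p) ^+ inv A C) *: tens 'f_A (mul 'f_C w)).
Proof.
rewrite /Rdiv /= tmap_tens /= Delta_rU.
pose f : Lam2 F B -> Lam2 F B := (idfun ⊗ nabla) \o assocr \o tensr w.
rewrite -[LHS]/(f (ssum _ _)) [LHS](linear_ssum f); apply: eq_ssum => A C _ _.
rewrite [LHS](linearZ_LR f); congr (_ *: _).
apply: (@eq_linear _ _ _ ((idfun ⊗ nabla) \o assocr \o tens 'f_(A, C))
  (tens 'f_A \o mul 'f_C)) => Y.
by rewrite /= tensUU assocrU tmapU -mul_nabla.
Qed.

Lemma ssum_mul_deg (P : nat -> bool) (c : F) D n :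
  (#|` D| = n -> shuffle_sum p D (fun k => (P k)%:R) = c) ->
  ssum D (fun A C =>
    ((P #|` A|)%:R * (#|` D| == n)%:R * (- p) ^+ inv A C) *: mul 'f_A 'f_C) =
  ((#|` D| == n)%:R * c) *: 'f_D :> Lam F B.
Proof.
move=> Dn; case: (eqVneq #|` D| n) => [/Dn<-|_].
  rewrite mul1r -ssum_mul_shuffle; apply: eq_ssum => A C _ _.
  by rewrite mulr1 mulrC.
rewrite mulr0n mul0r scale0r; transitivity (ssum D (fun _ _ => 0 : Lam F B)).
  by apply: eq_ssum => A C _ _; rewrite mulr0 mul0r scale0r.
exact: big1_eq.
Qed.

(** Splitting off one letter on the right and multiplying back yields $\binom{i+1}{i}_p=[i+1]_p$;
    [ssum_mul_succl] does the same on the left. *)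
Lemma ssum_mul_succr D i :
  ssum D (fun A C =>
    ((#|` A| == i)%:R * (#|` C| == 1%N)%:R * (- p) ^+ inv A C) *: mul 'f_A 'f_C) =
  ((#|` D| == i.+1)%:R * numberp p i.+1) *: 'f_D :> Lam F B.
Proof.
rewrite -(@ssum_mul_deg (fun k => k == i)); last exact: shuffle_sum_pred.
apply: eq_ssum => A C eD dAC; rewrite (card_split eD dAC).
case: (eqVneq #|` A| i) => [->|_]; last by rewrite !mul0r.
by rewrite -(addn1 i) eqn_add2l.
Qed.

Lemma ssum_mul_succl D j :
  ssum D (fun A C =>
    ((#|` A| == 1%N)%:R * (#|` C| == j)%:R * (- p) ^+ inv A C) *: mul 'f_A 'f_C) =
  ((#|` D| == j.+1)%:R * numberp p j.+1) *: 'f_D :> Lam F B.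
Proof.
rewrite -(@ssum_mul_deg (fun k => k == 1%N)); last by move<-; exact: shuffle_sum_eq1.
apply: eq_ssum => A C eD dAC; rewrite (card_split eD dAC).
case: (eqVneq #|` A| 1%N) => [->|_]; last by rewrite !mul0r.
by rewrite -(add1n j) eqn_add2l.
Qed.

(** Two successive extractions from the right factor form a splitting into three parts. Rebracketing
    brings together the two extracted parts, of degrees $i$ and $1$, whose product contributes
    $[i+1]_p$. *)
Lemma Lop_Ldiv i z :
  Lop Delta (Ldiv Delta i z) = numberp p i.+1 *: Ldiv Delta i.+1 z.
Proof.
apply: (@eq_linear _ _ _ (Ldiv Delta 1 \o Ldiv Delta i)
  (numberp p i.+1 \*: Ldiv Delta i.+1)) => -[X Y] /=.
rewrite -tensUU !Ldiv_tensr [LHS](linear_ssum (Ldiv Delta 1)) scaler_ssum.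
pose h A C1 C2 := ((#|` A| == i)%:R * (#|` C1| == 1%N)%:R * (- p) ^+ inv A C1 *
  ((- p) ^+ inv A C2 * (- p) ^+ inv C1 C2)) *: tens (mul (mul 'f_X 'f_A) 'f_C1) 'f_C2.
transitivity (ssum Y (fun A C => ssum C (fun C1 C2 => h A C1 C2))).
  apply: eq_ssum => A C _ _; rewrite [LHS](linearZ_LR (Ldiv Delta 1)) /= Ldiv_tensr.
  rewrite scaler_ssum; apply: eq_ssum => C1 C2 -> dC.
  by rewrite [LHS]scalerA /h (invUr _ dC) exprD; apply: eq_scale; ring.
rewrite -ssum_assoc; apply: eq_ssum => D C _ _.
pose g : Lam F B -> Lam2 F B := tensr 'f_C \o mul 'f_X.
transitivity ((- p) ^+ inv D C *: g (ssum D (fun A1 A2 =>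
  ((#|` A1| == i)%:R * (#|` A2| == 1%N)%:R * (- p) ^+ inv A1 A2) *: mul 'f_A1 'f_A2))).
  rewrite [X in _ *: X](linear_ssum g) scaler_ssum; apply: eq_ssum => A1 A2 -> dA.
  rewrite [X in _ *: X](linearZ_LR g) /= scalerA /g /= /tensr -mulA /h.
  by rewrite (invUl _ dA) exprD; apply: eq_scale; ring.
rewrite ssum_mul_succr [X in _ *: X](linearZ_LR g) /= /g /= /tensr !scalerA.
by apply: eq_scale; ring.
Qed.

(** Mirror image of [Lop_Ldiv]: the second extraction takes the letter that stands just before the
    part already moved, so the middle part has degree $1$. *)
Lemma Rop_Rdiv j z :
  Rop Delta (Rdiv Delta j z) = numberp p j.+1 *: Rdiv Delta j.+1 z.
Proof.
apply: (@eq_linear _ _ _ (Rdiv Delta 1 \o Rdiv Delta j)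
  (numberp p j.+1 \*: Rdiv Delta j.+1)) => -[X Y] /=.
rewrite -tensUU !Rdiv_tensl [LHS](linear_ssum (Rdiv Delta 1)) scaler_ssum.
pose h A1 A2 C := ((#|` A2| == 1%N)%:R * (#|` C| == j)%:R * (- p) ^+ inv A2 C *
  ((- p) ^+ inv A1 C * (- p) ^+ inv A1 A2)) *: tens 'f_A1 (mul 'f_A2 (mul 'f_C 'f_Y)).
transitivity (ssum X (fun A C => ssum A (fun A1 A2 => h A1 A2 C))).
  apply: eq_ssum => A C _ _; rewrite [LHS](linearZ_LR (Rdiv Delta 1)) /= Rdiv_tensl.
  rewrite scaler_ssum; apply: eq_ssum => A1 A2 -> dA.
  by rewrite [LHS]scalerA /h (invUl _ dA) exprD; apply: eq_scale; ring.
rewrite ssum_assoc; apply: eq_ssum => A D _ _.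
pose g : Lam F B -> Lam2 F B := tens 'f_A \o rmul 'f_Y.
transitivity ((- p) ^+ inv A D *: g (ssum D (fun C1 C2 =>
  ((#|` C1| == 1%N)%:R * (#|` C2| == j)%:R * (- p) ^+ inv C1 C2) *: mul 'f_C1 'f_C2))).
  rewrite [X in _ *: X](linear_ssum g) scaler_ssum; apply: eq_ssum => C1 C2 -> dC.
  rewrite [X in _ *: X](linearZ_LR g) /= scalerA /g /= /rmul mulA /h.
  by rewrite (invUr _ dC) exprD; apply: eq_scale; ring.
rewrite ssum_mul_succl [X in _ *: X](linearZ_LR g) /= /g /= !scalerA.
by apply: eq_scale; ring.
Qed.

Lemma Ldiv0 z : Ldiv Delta 0 z = z.
Proof.
apply: (@eq_linear _ _ _ (Ldiv Delta 0) idfun) => -[X Y] /=.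
rewrite -tensUU Ldiv_tensr ssum_bot => [|A C A0].
  by rewrite cardfs0 inv0l mulx1 mul1r scale1r.
by rewrite cardfs_eq0 (negPf A0) mul0r scale0r.
Qed.

Lemma Rdiv0 z : Rdiv Delta 0 z = z.
Proof.
apply: (@eq_linear _ _ _ (Rdiv Delta 0) idfun) => -[X Y] /=.
rewrite -tensUU Rdiv_tensl ssum_top => [|A C eX AX].
  by rewrite cardfs0 inv0r mul1x mul1r scale1r.
rewrite cardfs_eq0; case: eqP => [C0|_]; last by rewrite mul0r scale0r.
by rewrite eX C0 fsetU0 eqxx in AX.
Qed.

Lemma factpS n : factp p n.+1 = factp p n * numberp p n.+1.
Proof. by rewrite /factp big_nat_recr. Qed.

Lemma iter_Lop i z : iter i (Lop Delta) z = factp p i *: Ldiv Delta i z.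
Proof.
elim: i => [|i IHi]; first by rewrite /factp big_geq //= Ldiv0 scale1r.
rewrite /= IHi [LHS](linearZ_LR (Ldiv Delta 1)) /= [X in _ *: X]Lop_Ldiv scalerA.
exact: eq_scale (esym (factpS i)).
Qed.

Lemma iter_Rop j z : iter j (Rop Delta) z = factp p j *: Rdiv Delta j z.
Proof.
elim: j => [|j IHj]; first by rewrite /factp big_geq //= Rdiv0 scale1r.
rewrite /= IHj [LHS](linearZ_LR (Rdiv Delta 1)) /= [X in _ *: X]Rop_Rdiv scalerA.
exact: eq_scale (esym (factpS j)).
Qed.

Hypothesis numberp_neq0 : forall n : nat, (1 <= n)%N -> numberp p n != 0.

Lemma factp_neq0 n : factp p n != 0.
Proof.
elim: n => [|n IHn]; first by rewrite /factp big_geq // oner_eq0.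
by rewrite factpS mulf_neq0 // numberp_neq0.
Qed.

Lemma divpow_Rop j z : divpow p j (Rop Delta) z = Rdiv Delta j z.
Proof. by rewrite /divpow iter_Rop scalerA mulVf ?factp_neq0 // scale1r. Qed.

Lemma divpow_Lop t i z :
  divpow p i (fun z => t *: Lop Delta z) z = t ^+ i *: Ldiv Delta i z.
Proof.
have iterE : iter i (fun z => t *: Lop Delta z) z = t ^+ i *: iter i (Lop Delta) z.
  elim: i => [|i IHi]; first by rewrite expr0 scale1r.
  rewrite /= IHi [X in _ *: X](linearZ_LR (Ldiv Delta 1)) /= scalerA.
  exact: eq_scale (esym (exprS t i)).
rewrite /divpow [X in _ *: X]iterE iter_Lop !scalerA.
by apply: eq_scale; rewrite mulrAC mulVf ?factp_neq0 // mul1r.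
Qed.

End DividedPowers.

(** * The R-matrix *)

HB.instance Definition _ {disp : Order.disp_t} {B : orderType disp} {F : fieldType}
    (T : {linear Lam2 F B -> Lam2 F B}) (Delta : {linear Lam F B -> Lam2 F B})
    (S : {linear Lam F B -> Lam F B}) t :=
  GRing.isLinear.Build F _ _ *:%R (@Rmatrix disp B F T Delta S t)
    (linearP ((phi t ⊗ lambdaR T Delta S t) \o assocr \o (T ⊗ idfun) \o assocl
      \o (idfun ⊗ Delta))).

Section Rmatrix.
Context {disp : Order.disp_t} {B : orderType disp} {F : fieldType}.
Implicit Types (a b : B) (A C D E G X Y : {fset B}) (w x y : Lam F B) (z : Lam2 F B).

Lemma tmap_piL_supp m n i j z : supported (deg2 m n) z ->
  (piL i ⊗ piL j) z = ((m == i)%:R * (n == j)%:R) *: z.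
Proof.
move=> zmn; apply: (@eq_linear_supp _ _ _ _ _ (piL i ⊗ piL j)
  (((m == i)%:R * (n == j)%:R) \*: idfun) zmn) => -[X Y] /andP[/= /eqP Xm /eqP Yn].
by rewrite tmapU !piLU Xm Yn tensZl tensZr scalerA tensUU.
Qed.

Lemma tmap_piLl_supp m n i z : supported (deg2 m n) z ->
  (piL i ⊗ idfun) z = (m == i)%:R *: z.
Proof.
move=> zmn; apply: (@eq_linear_supp _ _ _ _ _ (piL i ⊗ idfun)
  ((m == i)%:R \*: idfun) zmn) => -[X Y] /andP[/= /eqP Xm _].
by rewrite tmapU piLU Xm tensZl tensUU.
Qed.

(** Left multiplication by $f_C$ shifts degrees by $|C|$. The indicator discards $|C|>i$, where the
    subtraction would be truncated to $0$. *)
Lemma piL_mul i C x :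
  piL i (mul 'f_C x) = (#|` C| <= i)%:R *: mul 'f_C (piL (i - #|` C|) x).
Proof.
apply: (@eq_linear _ _ _ (piL i \o mul 'f_C)
  ((#|` C| <= i)%:R \*: (mul 'f_C \o piL (i - #|` C|)))) => A /=.
rewrite piLU mulZr mulUU linearZ_LR /= piLU !scalerA /mulc.
case: ifP => dCA; last by rewrite !(mul0r, mulr0) !scale0r.
apply: eq_scale; rewrite (card_split (erefl _) dCA).
case: leqP => [Ci|iC]; last first.
  by rewrite mul0r mul0r gtn_eqF ?mulr0 // ltn_addr.
by rewrite mul1r mulrC; congr (_%:R * _); rewrite -[in LHS](subnKC Ci) eqn_add2l.
Qed.

Lemma tmap_piL_mull i C z :
  (piL i ⊗ idfun) ((mul 'f_C ⊗ idfun) z) =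
  (#|` C| <= i)%:R *: (mul 'f_C ⊗ idfun) ((piL (i - #|` C|) ⊗ idfun) z).
Proof.
apply: (@eq_linear _ _ _ ((piL i ⊗ idfun) \o (mul 'f_C ⊗ idfun))
  ((#|` C| <= i)%:R \*: ((mul 'f_C ⊗ idfun) \o (piL (i - #|` C|) ⊗ idfun)))).
move=> -[X Y] /=; rewrite !tmapU tmap_tens /= piL_mul tensZl.
by rewrite tmap_tens.
Qed.

Variables (p t : F) (T : {linear Lam2 F B -> Lam2 F B}).
Hypothesis hT : is_braiding p T.
Variable Delta : {linear Lam F B -> Lam2 F B}.
Hypothesis hDelta : is_coproduct T Delta.

Lemma braid_rmul_deg E A C :
  supported (deg2 #|` A| (#|` E| + #|` C|)%N) ((idfun ⊗ rmul 'f_C) (T 'f_(E, A))).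
Proof.
apply: (supported_linear (f := idfun ⊗ rmul 'f_C) (@braid_deg _ _ _ p T hT E A)).
move=> -[X Y] /andP[/= XA YE]; rewrite tmapU; apply: supported_tens.
  exact: supportedU.
by apply: supported_mul; rewrite // /deg eqxx.
Qed.

Lemma mull_mull A C (f : Lam F B -> Lam F B) z :
  (mul 'f_A ⊗ idfun) ((mul 'f_C ⊗ f) z) = mulc A C *: (mul 'f_(A `|` C) ⊗ f) z.
Proof.
apply: (@eq_linear _ _ _ ((mul 'f_A ⊗ idfun) \o (mul 'f_C ⊗ f))
  (mulc A C \*: (mul 'f_(A `|` C) ⊗ f))) => -[X Y] /=.
by rewrite !tmapU tmap_tens /= -mulA mulUU mulZl tensZl.
Qed.

(* With S(f_C) = gamma f_C this reads S(f')Delta(f''g) = (id (x) nabla)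
   (T (x) id)(f (x) Delta g): the axiom for Delta nabla on f''g produces S(f')f''
   on the left of the braiding, and the antipode cancels it. *)
Lemma antipode_twist E G :
  ssum E (fun C D => (gammap p #|` C| * (- p) ^+ inv C D) *:
    (mul 'f_C ⊗ idfun) (Delta (mul 'f_D 'f_G))) =
  ssum G (fun A C => (- p) ^+ inv A C *: (idfun ⊗ rmul 'f_C) (T 'f_(E, A))).
Proof.
pose h C D1 D2 := ssum G (fun G1 G2 =>
  (gammap p #|` C| * (- p) ^+ inv C D1 * mulc C D1 *
    ((- p) ^+ inv C D2 * (- p) ^+ inv D1 D2 * (- p) ^+ inv G1 G2)) *:
  (mul 'f_(C `|` D1) ⊗ rmul 'f_G2) (T 'f_(D2, G1))).
transitivity (ssum E (fun C D => ssum D (fun D1 D2 => h C D1 D2))).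
  apply: eq_ssum => C D _ _; rewrite (coproduct_mul hT hDelta).
  rewrite [X in _ *: X](linear_ssum (mul 'f_C ⊗ idfun)) scaler_ssum.
  apply: eq_ssum => D1 D2 -> dD.
  rewrite [X in _ *: X](linear_ssum (mul 'f_C ⊗ idfun)) scaler_ssum.
  apply: eq_ssum => G1 G2 _ _.
  rewrite [X in _ *: X](linearZ_LR (mul 'f_C ⊗ idfun)) /= mull_mull !scalerA.
  by rewrite (invUr _ dD) exprD; apply: eq_scale; ring.
(* Regroup $E=C\sqcup D_1\sqcup D_2$ by $A=C\sqcup D_1$. Only empty $A$ survives, which leaves
   $D_2=E$ and the right-hand side. *)
rewrite -ssum_assoc ssum_bot => [|A D A0].
  rewrite ssum0 /h; apply: eq_ssum => G1 G2 _ _.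
  rewrite /mulc fdisjoint0X !inv0l cardfs0 fsetU0 /gammap /= !expr0 !mul1r.
  by rewrite (eq_tmap mul1x (frefl _)).
rewrite /h ssum_exchange; transitivity (ssum G (fun _ _ => 0 : Lam2 F B)); last first.
  exact: big1_eq.
apply: eq_ssum => G1 G2 _ _.
(* Since $C\sqcup D_1=A$, the vector no longer depends on how $A$ is split, so the scalars can be
   summed by themselves. *)
transitivity (ssum A (fun C D1 => (gammap p #|` C| * (- p) ^+ inv C D1 * mulc C D1 *
    ((- p) ^+ inv A D * (- p) ^+ inv G1 G2)) *:
    (mul 'f_A ⊗ rmul 'f_G2) (T 'f_(D, G1)))).
  apply: eq_ssum => C D1 -> dC.
  by rewrite (invUl _ dC) exprD.
rewrite -ssum_scalel; set c := (- p) ^+ _ * _.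
suff -> : ssum A (fun C D1 =>
    gammap p #|` C| * (- p) ^+ inv C D1 * mulc C D1 * c) = 0 by rewrite scale0r.
(* The coefficients of product and coproduct combine to $p^{\mathrm{inv}}$, and the $p$-binomial
   theorem at $x=1$ gives $(1;p)_{|A|}=0$ for nonempty $A$. *)
transitivity (shuffle_sum p A (fun k => c * (gammap p k * 1 ^+ k))).
  apply: eq_ssum => C D1 _ dC; rewrite /mulc dC expr1n mulr1.
  have -> : p ^+ inv C D1 = (- p) ^+ inv C D1 * (-1) ^+ inv C D1.
    by rewrite -exprMn mulrN1 opprK.
  move: ((- p) ^+ inv C D1) ((-1) ^+ inv C D1) (gammap p #|` C|) c => u v g c.
  by ring.
rewrite shuffle_sum_mull shuffle_sum_gamma pochp1 ?mulr0 //.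
by rewrite cardfs_gt0.
Qed.

(** This is the part of [antipode_twist] whose first factor has degree $i$. On the antipode side,
    the terms with $|C|=k$ extract degree $m-k$ from $f_E$ and then degree $i-k$ from the product,
    which gives $\gamma_kL^{\langle i-k\rangle_p}R^{\langle m-k\rangle_p}$ with $m=|E|$. *)
Lemma LRsum_twist i E G :
  LRsum Delta p i #|` E| 'f_(E, G) =
  ssum G (fun A C => ((#|` A| == i)%:R * (- p) ^+ inv A C) *:
    (idfun ⊗ rmul 'f_C) (T 'f_(E, A))).
Proof.
transitivity ((piL i ⊗ idfun) (ssum G (fun A C =>
    (- p) ^+ inv A C *: (idfun ⊗ rmul 'f_C) (T 'f_(E, A))))); last first.
  rewrite [LHS](linear_ssum (piL i ⊗ idfun)); apply: eq_ssum => A C _ _.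
  rewrite [LHS](linearZ_LR (piL i ⊗ idfun)) /=.
  by rewrite (tmap_piLl_supp i (@braid_rmul_deg E A C)) scalerA mulrC.
rewrite -antipode_twist [RHS](linear_ssum (piL i ⊗ idfun)).
transitivity (\sum_(k < (minn i #|` E|).+1) ssum E (fun C D =>
    (#|` C| == k)%:R *: ((gammap p k * (- p) ^+ inv C D) *:
      (mul 'f_C ⊗ idfun) (Delta_l Delta (i - k) (mul 'f_D 'f_G))))).
  rewrite /LRsum; apply: eq_bigr => k _; rewrite -tensUU (Rdiv_tensl hT hDelta).
  rewrite [X in _ *: X](linear_ssum (Ldiv Delta (i - k))) scaler_ssum.
  apply: eq_ssum => C D eE dC.
  rewrite [X in _ *: X](linearZ_LR (Ldiv Delta (i - k))) /= Ldiv_tensl !scalerA.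
  apply: eq_scale; rewrite mulrCA; congr (_%:R * _).
  (* Because $k\le|E|$, the difference $|E|-k$ is not truncated, and $|D|=|E|-k$ says exactly that
     $|C|=k$. *)
  have := ltn_ord k; rewrite ltnS leq_min => /andP[_ kE].
  move: (card_split eE dC) kE; move: (nat_of_ord k) => n.
  by move: #|` E| #|` C| #|` D|; lia.
rewrite sum_ssum; apply: eq_ssum => C D eE dC.
rewrite (sum_pick _ _ (fun k => (gammap p k * (- p) ^+ inv C D) *:
      (mul 'f_C ⊗ idfun) (Delta_l Delta (i - k) (mul 'f_D 'f_G)))).
rewrite [RHS](linearZ_LR (piL i ⊗ idfun)) /= tmap_piL_mull ltnS leq_min.
have -> : (#|` C| <= #|` E|)%N by rewrite (card_split eE dC) leq_addr.
(* For $|C|>i$ no index $k$ matches on the left and the projection vanishes on the right. *)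
rewrite andbT; case: ifP => _; first by rewrite [X in _ = _ *: X]scale1r.
by rewrite [X in _ = _ *: X]scale0r scaler0.
Qed.

Variables (S : {linear Lam F B -> Lam F B}).
Hypothesis hS : is_antipode Delta S.

(** Group the terms of [RmatrixU] by the degree $i=|A|$ of the first factor: the scalar depends on
    $i$ alone, and what remains is the twist computed in [LRsum_twist]. *)
Lemma Rmatrix_LR E G :
  Rmatrix T Delta S t 'f_(E, G) =
  \sum_(i < #|` G|.+1) (t ^+ i * pochp (t * p ^+ #|` E|) p (#|` G| - i)) *:
    LRsum Delta p i #|` E| 'f_(E, G).
Proof.
rewrite (RmatrixU hT hDelta hS).
transitivity (\sum_(i < #|` G|.+1) ssum G (fun A C => (#|` A| == i)%:R *:
  ((t ^+ i * pochp (t * p ^+ #|` E|) p (#|` G| - i) * (- p) ^+ inv A C) *: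
    (idfun ⊗ rmul 'f_C) (T 'f_(E, A))))); last first.
  apply: eq_bigr => i _; rewrite LRsum_twist scaler_ssum.
  apply: eq_ssum => A C _ _; rewrite [LHS]scalerA [RHS]scalerA.
  by apply: eq_scale; ring.
rewrite sum_ssum; apply: eq_ssum => A C eG dA.
rewrite (sum_pick _ _ (fun i =>
  (t ^+ i * pochp (t * p ^+ #|` E|) p (#|` G| - i) * (- p) ^+ inv A C) *:
    (idfun ⊗ rmul 'f_C) (T 'f_(E, A)))).
by rewrite (card_split eG dA) ltnS leq_addr addKn.
Qed.

Lemma LRsum_deg i E G : (i <= #|` G|)%N ->
  supported (deg2 i (#|` E| + #|` G| - i)%N)
    (LRsum Delta p i #|` E| 'f_(E, G)).
Proof.
move=> iG; rewrite LRsum_twist /ssum big_seq; apply: supported_sum => A.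
rewrite fpowersetE => sA.
have := cardfsD G A; rewrite (fsetIidPr sA) => cGA.
case: (eqVneq #|` A| i) => [Ai|_]; last first.
  by rewrite mulr0n mul0r scale0r; apply: supported0.
apply: supportedZ; have := @braid_rmul_deg E A (G `\` A).
by rewrite cGA Ai addnBA.
Qed.

(** The summands of [Rmatrix_LR] have pairwise different bidegrees $(j,m+n-j)$, so the projection
    keeps only $j=i$. *)
Lemma Rmatrix_component m n i z : (i <= n)%N -> supported (deg2 m n) z ->
  (piL i ⊗ piL (m + n - i)%N) (Rmatrix T Delta S t z) =
  (t ^+ i * pochp (t * p ^+ m) p (n - i)) *: LRsum Delta p i m z.
Proof.
move=> le_in zmn; apply: (@eq_linear_supp _ _ _ _ _
  ((piL i ⊗ piL (m + n - i)%N) \o Rmatrix T Delta S t)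
  ((t ^+ i * pochp (t * p ^+ m) p (n - i)) \*: LRsum Delta p i m) zmn).
move=> -[E G] /andP[/= /eqP Em /eqP Gn]; rewrite Rmatrix_LR Em Gn.
rewrite [LHS](linear_sum (piL i ⊗ piL _)).
transitivity (\sum_(j < n.+1) (i == j :> nat)%:R *:
  ((t ^+ j * pochp (t * p ^+ m) p (n - j)) *: LRsum Delta p j m 'f_(E, G))).
  apply: eq_bigr => j _; rewrite [LHS](linearZ_LR (piL i ⊗ piL _)) /=.
  have jG : (j <= #|` G|)%N by rewrite Gn -ltnS.
  have := @LRsum_deg j E G jG; rewrite Em Gn => sj.
  rewrite [X in _ *: X = _](tmap_piL_supp i (m + n - i)%N sj).
  rewrite eq_sym; case: (eqVneq i j) => [->|_]; first by rewrite eqxx mul1r !scale1r.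
  by rewrite mul0r [X in _ *: X = _]scale0r scale0r scaler0.
rewrite (sum_pick _ _ (fun j => (t ^+ j * pochp (t * p ^+ m) p (n - j)) *:
  LRsum Delta p j m 'f_(E, G))).
by rewrite ltnS le_in.
Qed.

End Rmatrix.

Theorem theorem4 (disp : Order.disp_t) (B : orderType disp) (F : fieldType)
    (p t : F) (p_neq0 : p != 0) (t_neq0 : t != 0)
    (numberp_neq0 : forall n : nat, (1 <= n)%N -> numberp p n != 0)
    (T : {linear Lam2 F B -> Lam2 F B}) (hT : is_braiding p T)
    (Delta : {linear Lam F B -> Lam2 F B}) (hDelta : is_coproduct T Delta)
    (S : {linear Lam F B -> Lam F B}) (hS : is_antipode Delta S) :
  (forall E G : {fset B},
     Rmatrix T Delta S t << (E, G) >> =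
     \sum_(k < (minn #|` E| #|` G|).+1)
        (t ^+ k * gammap p k) *:
          Wp (#|` G| - k) (t * p ^+ #|` E|) (fun z => t *: Lop Delta z) p
            (divpow p (#|` E| - k) (Rop Delta) << (E, G) >>))
  /\
  (forall (m n i : nat), (i <= n)%N -> forall x : Lam2 F B,
     (piL i ⊗ piL (m + n - i)) (Rmatrix T Delta S t ((piL m ⊗ piL n) x)) =
     (t ^+ i * pochp (t * p ^+ m) p (n - i)) *:
       \sum_(k < (minn i m).+1)
          gammap p k *:
            ((nabla ⊗ idfun) \o assocl \o (idfun ⊗ Delta_l Delta (i - k))
             \o (idfun ⊗ nabla) \o assocr \o (Delta_r Delta (m - k) ⊗ idfun)
             \o (piL m ⊗ piL n)) x).
Proof.
split=> [E G|m n i le_in x].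
  rewrite !basE (Rmatrix_LR _ hT hDelta hS).
  set N := #|` G|; set m := #|` E|.
  pose h k i := (t ^+ i * pochp (t * p ^+ m) p (N - i) * gammap p k) *:
    Ldiv Delta (i - k) (Rdiv Delta (m - k) 'f_(E, G)).
  (* The index $k$ is given a fixed range, with its bounds as a filter, so that the two sums can be
     interchanged. *)
  transitivity (\sum_(i < N.+1) \sum_(k < N.+1 | (k <= i)%N && (k <= m)%N) h k i).
    apply: eq_bigr => i _; rewrite /LRsum scaler_sumr.
    have leN : ((minn i m).+1 <= N.+1)%N.
      by rewrite ltnS (leq_trans (geq_minl _ _)) // -ltnS.
    rewrite (big_ord_widen N.+1 (fun k => (t ^+ i * pochp (t * p ^+ m) p (N - i)) *:
      (gammap p k *: Ldiv Delta (i - k) (Rdiv Delta (m - k) 'f_(E, G)))) leN).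
    apply: eq_big => [k|k _]; first by rewrite ltnS leq_min.
    exact: scalerA.
  transitivity (\sum_(k < N.+1 | (k <= m)%N) \sum_(i < N.+1 | (k <= i)%N) h k i).
    rewrite [LHS](exchange_big_dep (fun k : 'I_N.+1 => (k <= m)%N)).
      by apply: eq_bigr => k km; apply: eq_bigl => i; rewrite km andbT.
    by move=> i k _ /andP[].
  have leN : ((minn m N).+1 <= N.+1)%N by rewrite ltnS geq_minr.
  rewrite [RHS](big_ord_widen N.+1 (fun k => (t ^+ k * gammap p k) *:
    Wp (N - k) (t * p ^+ m) (fun z => t *: Lop Delta z) p
      (divpow p (m - k) (Rop Delta) 'f_(E, G))) leN).
  apply: eq_big => [k|k km].
    by rewrite ltnS leq_min -[(k <= N)%N]ltnS ltn_ord andbT.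
  have kN : (k <= N)%N by rewrite -ltnS.
  (* Substitute $i=j+k$: the inner sum becomes $W_{N-k}$, and $t^i$ splits into the outer $t^k$ and
     the $t^j$ of $(tL)^{\langle j\rangle_p}$. *)
  rewrite -(big_geq_mkord k N.+1 predT (h k)) -{1}[k : nat]add0n big_addn subSn //.
  rewrite big_mkord /Wp scaler_sumr; apply: eq_bigr => j _.
  rewrite (divpow_Lop hT hDelta numberp_neq0) (divpow_Rop hT hDelta numberp_neq0).
  rewrite !scalerA /h addnK -subnDA [(k + j)%N]addnC exprD.
  by apply: eq_scale; ring.
(* The projected element is homogeneous of bidegree $(m,n)$, which is what [Rmatrix_component] asks
   for. *)
have zmn : supported (deg2 m n) ((piL m ⊗ piL n) x).
  apply: (supported_linear (P := predT) (f := piL m ⊗ piL n)) => // -[E G] _.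
  rewrite /= tmapU !piLU tensZl tensZr scalerA tensUU.
  case: (eqVneq #|` E| m) => [Em|_]; last first.
    by rewrite mulr0n mul0r scale0r; apply: supported0.
  case: (eqVneq #|` G| n) => [Gn|_]; last first.
    by rewrite mulr0n mulr0 scale0r; apply: supported0.
  by apply: supportedZ; apply: supportedU; rewrite /deg2 /deg /= Em Gn !eqxx.
exact: (Rmatrix_component t hT hDelta hS le_in zmn).
Qed.
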